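(* Let $k,d$ be constants and let $F:\mathcal{G}(n)\to\mathbb{N}$ be a graph parameter whose circuit representation can be expressed as a Sum-NC$^0$ circuit with gate fan-in at most $k$ and depth $d$, such that $\mathbb{E}_{G'\sim\mathcal{G}_{n,p}}[F(x^{G'})]>0$. Let $p=\Omega\left(1/n^{2/(2k^d-1)}\right)$. Then the $(\mathcal{G}_{n,p},\rho_F)$-quality control problem can be solved using $1/p^{O(k^d)}$ queries to the adjacency matrix of the input graph and running time $1/p^{O(k^d)}$.
   Context: Quality control: let $\mathcal{X}$ be a set, $\rho:\mathcal{X}\to\mathbb{R}_{\ge 0}$, $\varepsilon>0$ a fixed small constant, and $\mathcal{D}$ a distribution on $\mathcal{X}$ with $\Pr_{x\sim\mathcal{D}}[|\rho(x)-1|\le\varepsilon]\ge 9/10$. A (randomized) $(\mathcal{D},\rho)$-quality control algorithm $A$ must satisfy: (i) $\Pr_{x\sim\mathcal{D},R}[A(x)=\textsc{Accept}]\ge 2/3$; (ii) for every $x$ with $|\rho(x)-1|>\varepsilon$, $\Pr_R[A(x)=\textsc{Reject}]\ge 2/3$ ($R$ the algorithm's randomness). $\mathcal{G}(n)$ is the family of graphs on $n$ vertices; a graph parameter is a function on $\mathcal{G}(n)$ invariant under permutations of the vertices. A graph $G$ is identified with $x^G\in\{0,1\}^{\binom{n}{2}}$ indicating which pairs are edges; the circuit representation of $F$ is a circuit computing $F(G)$ from $x^G$. A Sum-NC$^0$ circuit $C=\sum\circ C_{N,m}$ is a summation gate $\sum_m:\{0,1\}^m\to\mathbb{N}$ composed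 with a circuit $C_{N,m}:\{0,1\}^N\to\{0,1\}^m$ of AND, OR, NOT gates with constant fan-in $k$, constant depth $d$, and $m=\mathrm{poly}(N)$. $\rho_F(G)=F(G)/\mathbb{E}_{G'\sim\mathcal{G}_{n,p}}[F(G')]$. $\mathcal{G}_{n,p}$ is the Erdős–Rényi distribution.
   Formalization: The formal theorem assumes in addition p ≤ 1 − δ for an arbitrary constant δ > 0 (constants may depend on δ); without it the claim fails, e.g. for F = number of non-edges and p = 1 − M/n². *)

(* Defs.v *)
From HB Require Import structures.
From mathcomp Require Import all_boot all_order all_fingroup all_algebra.
From mathcomp Require Import reals exp.

Set Implicit Arguments.
Unset Strict Implicit.
Unset Printing Implicit Defensive.

Import Order.TTheory GRing.Theory Num.Theory.

(** * Graphs on [n] labelled vertices, given by their adjacency matrices *)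

Definition is_graph (n : nat) (A : 'M[bool]_n) : bool :=
  (A^T == A)%R && [forall i, ~~ A i i].

Record graph (n : nat) := Graph { adj : 'M[bool]_n; _ : is_graph adj }.

HB.instance Definition _ (n : nat) := [isSub for @adj n].
HB.instance Definition _ (n : nat) := [Finite of graph n by <:].

Definition vpairs (n : nat) : seq ('I_n * 'I_n) :=
  [seq e : 'I_n * 'I_n <- enum {: 'I_n * 'I_n} | (e.1 < e.2)%N].

Lemma size_vpairs (n : nat) : size (vpairs n) = 'C(n, 2).
Proof.
rewrite /vpairs size_filter -sum1_count big_enum_cond /=.
transitivity (\sum_(j < n) \sum_(i < n | i < j) 1)%N.
  by rewrite (exchange_big_dep xpredT) //= pair_big_dep.
rewrite -bin2_sum big_mkord; apply: eq_bigr => j _.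
by rewrite -(big_ord_widen _ (fun=> 1%N) (ltnW (ltn_ord j))) sum1_card card_ord.
Qed.

(* The string x^G : one bit for each unordered pair of vertices. *)
Definition graph_bits (n : nat) (G : graph n) : 'C(n, 2).-tuple bool :=
  tcast (size_vpairs n) [tuple of [seq adj G e.1 e.2 | e <- in_tuple (vpairs n)]].

Definition graph_parameter (n : nat) (F : graph n -> nat) : Prop :=
  forall (s : 'S_n) (G H : graph n),
    (forall i j, adj H i j = adj G (s i) (s j)) -> F H = F G.

(** * Circuits *)

(* In a circuit with N inputs, wire i < N is the i-th input and wire N + j is
   the output of the j-th gate. *)
Inductive gate : Type :=
| AndGate of seq nat
| OrGate of seq nat
| NotGate of nat.

Definition gate_args (g : gate) : seq nat :=
  match g with AndGate s | OrGate s => s | NotGate i => [:: i] end.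

Definition gate_eval (v : seq bool) (g : gate) : bool :=
  match g with
  | AndGate s => all (nth false v) s
  | OrGate s => has (nth false v) s
  | NotGate i => ~~ nth false v i
  end.

Record circuit (N m : nat) := Circuit {
  gates : seq gate;
  outputs : m.-tuple nat;
  gates_wf : forall j, (j < size gates)%N ->
    all (fun i => i < N + j)%N (gate_args (nth (NotGate 0) gates j));
  outputs_wf : all (fun i => i < N + size gates)%N outputs
}.

Definition wire_values (x : seq bool) (gs : seq gate) : seq bool :=
  foldl (fun v g => rcons v (gate_eval v g)) x gs.

Definition wire_depths (N : nat) (gs : seq gate) : seq nat :=
  foldl (fun v g => rcons v (\max_(i <- gate_args g) nth 0 v i).+1)
    (nseq N 0%N) gs.

Definition circuit_eval (N m : nat) (C : circuit N m) (x : N.-tuple bool) :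
    m.-tuple bool :=
  [tuple of [seq nth false (wire_values x (gates C)) i | i <- outputs C]].

Definition fanin_at_most (N m : nat) (C : circuit N m) (k : nat) : bool :=
  all (fun g => size (gate_args g) <= k)%N (gates C).

Definition depth_at_most (N m : nat) (C : circuit N m) (d : nat) : bool :=
  all (fun t => t <= d)%N (wire_depths N (gates C)).

Definition sum_gate (m : nat) (y : m.-tuple bool) : nat :=
  (\sum_(i < m) tnth y i)%N.

(* F(G) = sum_gate (C (x^G)) for a circuit C of fan-in at most k and depth at
   most d; the number a witnesses that the number of outputs is poly(N). *)
Definition sum_NC0 (k d a n : nat) (F : graph n -> nat) : Prop :=
  let N := 'C(n, 2) in
  exists (m : nat) (C : circuit N m),
    [/\ (m <= a * N ^ a + a)%N,
        fanin_at_most C k,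
        depth_at_most C d &
        forall G, F G = sum_gate (circuit_eval C (graph_bits G))].

(** * Randomized word-RAM algorithms with oracle access to a matrix

   Memory cells are addressed by natural numbers and hold words, i.e. numbers
   smaller than a fixed modulus [W].  Every command below takes one unit of
   time, so in particular a word operation, a uniform random word in a given
   range and a query all have unit cost. *)

Inductive binop := Add | Sub | Mul | Div | Mod | Lt.

Inductive cmd : Type :=
| Skip
| Const (a v : nat)               (* M[a] := v *)
| Arith (o : binop) (a b c : nat) (* M[a] := M[b] o M[c] *)
| Fetch (a b : nat)               (* M[a] := M[M[b]] *)
| Store (a b : nat)               (* M[M[a]] := M[b] *)
| Rand (a b : nat)                (* M[a] := uniform in {0, ..., M[b]} *)
| Query (a b c : nat)             (* M[a] := entry (M[b], M[c]) of the input *)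
| Accept
| Reject
| Seq (c1 c2 : cmd)
| If (a : nat) (c1 c2 : cmd)      (* branch on M[a] <> 0 *)
| While (a : nat) (c : cmd).      (* loop as long as M[a] <> 0 *)

Definition binop_eval (o : binop) (x y : nat) : nat :=
  match o with
  | Add => x + y
  | Sub => x - y
  | Mul => x * y
  | Div => x %/ y
  | Mod => x %% y
  | Lt => x < y
  end%N.

Definition memory := nat -> nat.

Definition update (M : memory) (a v : nat) : memory :=
  fun i => if i == a then v else M i.

(* A stack of commands still to be executed, and the memory. *)
Definition config : Type := (seq cmd * memory)%type.

Inductive action : Type :=
| Halt of bool                          (* true = accept, false = reject *)
| Next of config
| Ask of nat & nat & (bool -> config)
| Draw of nat & (nat -> config).

(* A program that terminates without a verdict rejects. *)
Definition step (W : nat) (cf : config) : action :=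
  let: (st, M) := cf in
  match st with
  | [::] => Halt false
  | Skip :: st' => Next (st', M)
  | Const a v :: st' => Next (st', update M a (v %% W))
  | Arith o a b c :: st' =>
      Next (st', update M a (binop_eval o (M b) (M c) %% W))
  | Fetch a b :: st' => Next (st', update M a (M (M b)))
  | Store a b :: st' => Next (st', update M (M a) (M b))
  | Rand a b :: st' => Draw (M b) (fun v => (st', update M a (v %% W)))
  | Query a b c :: st' =>
      Ask (M b) (M c) (fun e : bool => (st', update M a (e %% W)))
  | Accept :: _ => Halt true
  | Reject :: _ => Halt false
  | Seq c1 c2 :: st' => Next ([:: c1, c2 & st'], M)
  | If a c1 c2 :: st' => Next ((if M a == 0 then c2 else c1) :: st', M)
  | While a c :: st' =>
      Next (if M a == 0 then st' else [:: c, While a c & st'], M)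
  end%N.

Definition oracle := nat -> nat -> bool.

(* For all random choices, at most t steps and at most q queries are made
   before a verdict is reached. *)
Fixpoint halts_within (W : nat) (O : oracle) (q t : nat) (cf : config) : Prop :=
  match step W cf, t with
  | Halt _, _ => True
  | _, 0 => False
  | Next cf', t'.+1 => halts_within W O q t' cf'
  | Ask i j f, t'.+1 =>
      if q is q'.+1 then halts_within W O q' t' (f (O i j)) else False
  | Draw r f, t'.+1 => forall v, (v <= r)%N -> halts_within W O q t' (f v)
  end.

(* The probability that verdict b is reached within t steps. *)
Fixpoint pr_verdict (R : realType) (W : nat) (O : oracle) (b : bool) (t : nat)
    (cf : config) : R :=
  match step W cf, t with
  | Halt b', _ => (b' == b)%:R
  | _, 0 => 0
  | Next cf', t'.+1 => pr_verdict R W O b t' cf'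
  | Ask i j f, t'.+1 => pr_verdict R W O b t' (f (O i j))
  | Draw r f, t'.+1 =>
      (\sum_(v < r.+1) pr_verdict R W O b t' (f v)) / r.+1%:R
  end%R.

(* Entries outside of the matrix read as 0. *)
Definition adj_oracle (n : nat) (G : graph n) : oracle := fun i j =>
  match insub i, insub j with
  | Some u, Some v => adj G u v
  | _, _ => false
  end.

(* Words of w * (floor (log2 n) + 1) bits. *)
Definition word_modulus (w n : nat) : nat := (2 ^ (w * (trunc_log 2 n).+1))%N.

(* The memory initially holds n in cell 0, followed by the words [par]. *)
Definition init_config (W : nat) (prog : cmd) (n : nat) (par : seq nat) :
    config :=
  ([:: prog], fun i => nth 0%N (n :: par) i %% W)%N.

Local Open Scope ring_scope.

(** * Random graphs and quality control *)

Definition gnp (R : realType) (n : nat) (p : R) (G : graph n) : R :=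
  \prod_(b <- graph_bits G) (if b then p else 1 - p).

Definition prob (R : realType) (X : finType) (D : X -> R) (P : pred X) : R :=
  \sum_(x | P x) D x.

Definition expectation (R : realType) (X : finType) (D f : X -> R) : R :=
  \sum_x D x * f x.

Definition qc_promise (R : realType) (X : finType) (D rho : X -> R) (eps : R) :
    Prop :=
  9 / 10 <= prob D (fun x => `|rho x - 1| <= eps).

(* [pr b x] is the probability, over the internal randomness of the algorithm,
   that the verdict on input x is b. *)
Definition quality_control (R : realType) (X : finType) (D rho : X -> R)
    (eps : R) (pr : bool -> X -> R) : Prop :=
  2 / 3 <= expectation D (pr true) /\
  (forall x, eps < `|rho x - 1| -> 2 / 3 <= pr false x).

Definition rho_param (R : realType) (n : nat) (p : R) (F : graph n -> nat)
    (G : graph n) : R :=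
  (F G)%:R / expectation (gnp p) (fun G' => (F G')%:R).

(* [prog], run with modulus W on parameters [par], solves the quality control
   problem for (gnp p, rho_param p F) with at most q queries and t steps. *)
Definition solves_qc (R : realType) (n : nat) (p : R) (F : graph n -> nat)
    (eps : R) (W : nat) (prog : cmd) (par : seq nat) (q t : nat) : Prop :=
  let cf := init_config W prog n par in
  (forall G : graph n, halts_within W (adj_oracle G) q t cf) /\
  quality_control (gnp p) (rho_param p F) eps
    (fun b G => pr_verdict R W (adj_oracle G) b t cf).

(* Main.v *)
(* Every output of the circuit reads at most K = k^d pairs of vertices, hence at
   most v = 2K vertices.  Averaging the invariant F over all relabellings, and
   moving the vertices read by each output to {0, ..., v-1}, gives
   F(G) = E_s [g(G^s)] with s a uniform permutation and g a function of the graph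
   induced on the first v vertices.  If M is the number of outputs that are not
   identically 0, then g <= M, and each of these outputs is 1 with probability at
   least (delta p)^K, so that M (delta p)^K <= E[F].

   Accordingly F(G) is estimated by sampling v vertices and looking g up in a
   table that is part of the input: by Chebyshev, O((1/p)^K) samples determine
   F(G)/E[F] up to a constant error.  This suffices if the values of F/E[F] that
   have to be rejected are separated by a constant from an interval of probability
   at least 9/10.  Two relabelled copies of g are independent unless they share a
   pair, which happens with probability O(1/n^2), whence
   Var F = O(M E[F] / n^2) = O(E[F]^2 / (n^2 p^K)), and F is concentrated if
   n^2 p^K is large.  Otherwise the lower bound on p leaves two cases: either
   K > 1 and n is bounded, or K = 1 and F is an affine function of the number of
   edges; in both cases F/E[F], if not concentrated, takes well-spaced values. *)

Require Import Defs.
From mathcomp Require Import all_boot all_order all_fingroup all_algebra.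
From mathcomp Require Import reals exp.
From mathcomp Require Import ring lra zify.

Set Implicit Arguments.
Unset Strict Implicit.
Unset Printing Implicit Defensive.

Import Order.TTheory GRing.Theory Num.Theory.
Local Open Scope ring_scope.

(** * Random graphs *)

Lemma adj_sym (n : nat) (G : graph n) i j : adj G i j = adj G j i.
Proof. by case: G => A /= /andP[/eqP eA _]; rewrite -{1}eA mxE. Qed.

Lemma adj_irr (n : nat) (G : graph n) i : adj G i i = false.
Proof. by case: G => A /= /andP[_ /forallP/(_ i)/negbTE]. Qed.

Lemma graph_ext (n : nat) (G H : graph n) :
  (forall i j : 'I_n, (i < j)%N -> adj G i j = adj H i j) -> G = H.
Proof.
move=> eGH; apply: val_inj; apply/matrixP => i j.
case: (ltngtP i j) => [/eGH //| /eGH|/val_inj ->]; last by rewrite !adj_irr.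
by rewrite adj_sym => ->; rewrite adj_sym.
Qed.

(** Only the values of [r] above the diagonal are read and then mirrored, so every [r], symmetric or
    not, yields a graph. *)
Definition graph_of_rel_mx (n : nat) (r : 'I_n -> 'I_n -> bool) : 'M[bool]_n :=
  \matrix_(i, j) if (i < j)%N then r i j else if (j < i)%N then r j i else false.

Lemma graph_of_rel_subproof (n : nat) (r : 'I_n -> 'I_n -> bool) :
  is_graph (graph_of_rel_mx r).
Proof.
apply/andP; split; last by apply/forallP => i; rewrite mxE ltnn.
by apply/eqP/matrixP => i j; rewrite !mxE; case: ltngtP.
Qed.

Definition graph_of_rel (n : nat) (r : 'I_n -> 'I_n -> bool) : graph n :=
  Graph (graph_of_rel_subproof r).

Lemma adj_graph_of_rel_lt (n : nat) (r : 'I_n -> 'I_n -> bool) (i j : 'I_n) :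
  (i < j)%N -> adj (graph_of_rel r) i j = r i j.
Proof. by move=> ij; rewrite /= mxE ij. Qed.

Lemma adj_graph_of_rel (n : nat) (r : 'I_n -> 'I_n -> bool) (i j : 'I_n) :
  (forall x y, r x y = r y x) -> (forall x, r x x = false) ->
  adj (graph_of_rel r) i j = r i j.
Proof. by move=> rS r0; rewrite /= mxE; case: ltngtP => // /val_inj ->. Qed.

Definition relabel (n : nat) (s : 'S_n) (G : graph n) : graph n :=
  graph_of_rel (fun i j => adj G (s i) (s j)).

Lemma adj_relabel (n : nat) (s : 'S_n) (G : graph n) i j :
  adj (relabel s G) i j = adj G (s i) (s j).
Proof.
by apply: adj_graph_of_rel => *; [apply: adj_sym|apply: adj_irr].
Qed.

Lemma relabelM (n : nat) (s t : 'S_n) (G : graph n) :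
  relabel t (relabel s G) = relabel (t * s)%g G.
Proof. by apply: graph_ext => i j _; rewrite !adj_relabel !permM. Qed.

Definition edge_weight (R : realType) (p : R) (b : bool) : R :=
  if b then p else 1 - p.

Lemma gnpE (R : realType) (n : nat) (p : R) (G : graph n) :
  gnp p G = \prod_(e : 'I_n * 'I_n | (e.1 < e.2)%N)
              edge_weight p (adj G e.1 e.2).
Proof.
rewrite /gnp /graph_bits.
have -> : \prod_(b <- tcast (size_vpairs n)
     [tuple of [seq adj G e.1 e.2 | e <- in_tuple (vpairs n)]])
     (if b then p else 1 - p) =
   \prod_(b <- [seq adj G e.1 e.2 | e <- vpairs n]) edge_weight p b.
  by rewrite val_tcast.
by rewrite big_map /vpairs big_filter big_enum_cond.
Qed.

(** A graph is a free choice of one bit for each pair [i < j], so this is distributivity of products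
    over sums. Independence of the edges enters through this identity. *)
Lemma sum_graph_prod (R : realType) (n : nat) (u : 'I_n * 'I_n -> bool -> R) :
  \sum_(G : graph n) \prod_(e : 'I_n * 'I_n | (e.1 < e.2)%N) u e (adj G e.1 e.2)
  = \prod_(e : 'I_n * 'I_n | (e.1 < e.2)%N) (u e true + u e false).
Proof.
pose P (e : 'I_n * 'I_n) := (e.1 < e.2)%N.
transitivity (\prod_(e | P e) \sum_(b : bool) u e b); last first.
  by apply: eq_bigr => e _; rewrite big_bool.
rewrite (big_distr_big_dep false).
(* Bits off the pairs [i < j] are set to [false], the default value of the functions over which the
   distributed product ranges. *)
pose enc (G : graph n) := [ffun e : 'I_n * 'I_n => P e && adj G e.1 e.2].
pose dec (f : {ffun 'I_n * 'I_n -> bool}) := graph_of_rel (fun i j => f (i, j)).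
rewrite (reindex_onto enc dec) /=.
  apply: eq_big => [G|G _]; last by apply: eq_bigr => e Pe; rewrite ffunE /P Pe.
  symmetry; apply/andP; split.
    apply/pfamilyP; split => //.
    by apply/supportP => e Pe; rewrite ffunE -[P e]/(e \in P) (negbTE Pe).
  apply/eqP/graph_ext => i j ij; rewrite adj_graph_of_rel_lt // ffunE /P /=.
  by rewrite ij.
move=> f /pfamilyP[/supportP fs _]; apply/ffunP => e; rewrite ffunE.
have [Pe|Pe] := boolP (P e); last by rewrite fs.
by rewrite /= adj_graph_of_rel_lt //; case: e Pe.
Qed.

Lemma edge_weight_sum (R : realType) (p : R) :
  edge_weight p true + edge_weight p false = 1.
Proof. by rewrite /edge_weight addrC subrK. Qed.

Lemma gnp_sum1 (R : realType) (n : nat) (p : R) :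
  \sum_(G : graph n) gnp p G = 1.
Proof.
under eq_bigr => G _ do rewrite gnpE.
rewrite (sum_graph_prod (fun _ => edge_weight p)).
by rewrite big1 // => e _; apply: edge_weight_sum.
Qed.

Lemma gnp_ge0 (R : realType) (n : nat) (p : R) (G : graph n) :
  0 <= p <= 1 -> 0 <= gnp p G.
Proof.
move=> /andP[p0 p1]; rewrite gnpE; apply: prodr_ge0 => e _.
by rewrite /edge_weight; case: ifP => _ //; rewrite subr_ge0.
Qed.

(** The indicator of agreement on [S] is itself a product over pairs, so it merges into the edge
    weights; each pair outside [S] then sums to 1. *)
Lemma prob_agree (R : realType) (n : nat) (p : R) (G0 : graph n)
    (S : {set 'I_n * 'I_n}) :
  (forall e, e \in S -> (e.1 < e.2)%N) ->
  \sum_(G : graph n | [forall e in S, adj G e.1 e.2 == adj G0 e.1 e.2]) gnp p G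
  = \prod_(e in S) edge_weight p (adj G0 e.1 e.2).
Proof.
move=> Slt.
pose u (e : 'I_n * 'I_n) b :=
  if (e \in S) && (b != adj G0 e.1 e.2) then 0 else edge_weight p b.
transitivity (\sum_(G : graph n)
   \prod_(e : 'I_n * 'I_n | (e.1 < e.2)%N) u e (adj G e.1 e.2)).
  rewrite big_mkcond; apply: eq_bigr => G _; case: ifP => [/forall_inP ag|].
    by rewrite gnpE; apply: eq_bigr => e _; rewrite /u; case: ifP => // /andP[/ag ->].
  move/negbT; rewrite negb_forall_in => /exists_inP[e eS ne].
  by rewrite (bigD1 e) /= ?Slt // /u eS ne mul0r.
rewrite sum_graph_prod (bigID (mem S)) /= [X in _ * X]big1 ?mulr1.
  apply: eq_big => [e|e]; first by case: (boolP (e \in S)) => [/Slt ->|]; rewrite ?andbF.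
  move=> /andP[_ eS]; rewrite /u eS /=.
  by case: (adj G0 _ _); rewrite /= ?addr0 ?add0r.
by move=> e /andP[_ /negbTE eS]; rewrite /u eS /=; apply: edge_weight_sum.
Qed.

(** The prescribed bits may be 0 or 1, so [r] has to lie below both [p] and [1 - p]. Applied to a
    graph [G0] on which a circuit output is 1, this bounds from below the probability of that
    output. *)
Lemma prob_agree_ge (R : realType) (n : nat) (p r : R) (G0 : graph n)
    (S : {set 'I_n * 'I_n}) (K : nat) :
  0 <= r <= 1 -> r <= p -> r <= 1 - p -> (#|S| <= K)%N ->
  (forall e, e \in S -> (e.1 < e.2)%N) ->
  r ^+ K <=
  \sum_(G : graph n | [forall e in S, adj G e.1 e.2 == adj G0 e.1 e.2]) gnp p G.
Proof.
move=> /andP[r0 r1] rp rq SK Slt; rewrite prob_agree //.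
apply: (@le_trans _ _ (r ^+ #|S|)); first exact: ler_wiXn2l.
rewrite -prodr_const; apply: ler_prod => e _; rewrite r0 /=.
by rewrite /edge_weight; case: ifP.
Qed.

(* Swapping two independent samples off [A] preserves their joint law; under it
   [f] reads only the first sample and [h] only the second. *)
Lemma expectation_indep (R : realType) (n : nat) (p : R)
    (A : rel 'I_n) (f h : graph n -> R) :
  (forall i j, A i j = A j i) ->
  (forall G H, (forall i j, A i j -> adj G i j = adj H i j) -> f G = f H) ->
  (forall G H, (forall i j, ~~ A i j -> adj G i j = adj H i j) -> h G = h H) ->
  expectation (gnp p) (fun G => f G * h G) =
  expectation (gnp p) f * expectation (gnp p) h.
Proof.
move=> As fA hA.
pose mrg (G H : graph n) := graph_of_rel (fun i j =>
  if A i j then adj G i j else adj H i j).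
have mrgE G H i j : adj (mrg G H) i j = if A i j then adj G i j else adj H i j.
  apply: adj_graph_of_rel => [x y|x]; first by rewrite As adj_sym (adj_sym H).
  by rewrite !adj_irr if_same.
have mrgK G H : mrg (mrg G H) (mrg H G) = G.
  by apply: graph_ext => i j _; rewrite !mrgE; case: (A i j).
pose sw (x : graph n * graph n) := (mrg x.1 x.2, mrg x.2 x.1).
have swK : involutive sw by case=> G H; rewrite /sw /= !mrgK.
have wsw G H : gnp p (mrg G H) * gnp p (mrg H G) = gnp p G * gnp p H.
  rewrite !gnpE -!big_split; apply: eq_bigr => e _ /=; rewrite !mrgE.
  by case: ifP => _ //; rewrite mulrC.
symmetry; rewrite /expectation big_distrlr /= pair_big /=.
rewrite (reindex_inj (inv_inj swK)) /=.
transitivity (\sum_(x : graph n * graph n)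
    (gnp p x.1 * (f x.1 * h x.1)) * gnp p x.2).
  apply: eq_bigr => -[G H] _ /=.
  have -> : f (mrg G H) = f G by apply: fA => i j Aij; rewrite mrgE Aij.
  have -> : h (mrg H G) = h G by apply: hA => i j /negbTE Aij; rewrite mrgE Aij.
  by rewrite mulrACA wsw; ring.
rewrite -(pair_big xpredT xpredT
  (fun G H => (gnp p G * (f G * h G)) * gnp p H)) /=.
by apply: eq_bigr => G _; rewrite -mulr_sumr gnp_sum1 mulr1.
Qed.

(** * Symmetrization and its variance *)

(** Some permutation that starts with the entries of [s], or the identity if there is none. Which
    extension is picked does not matter: only the values below [size s] are controlled. *)
Definition perm_of_seq (n : nat) (s : seq 'I_n) : 'S_n :=
  odflt 1%g [pick t : 'S_n | [forall i : 'I_n, (i < size s)%N ==> (t i == nth i s i)]].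

Lemma perm_of_seqE (n : nat) (s : seq 'I_n) (i j : 'I_n) :
  uniq s -> (i < size s)%N -> perm_of_seq s i = nth j s i.
Proof.
move=> us si; rewrite (set_nth_default i j si) /perm_of_seq.
case: pickP => [t /forallP/(_ i)|]; first by rewrite si => /eqP.
(* Such a permutation exists: list the remaining vertices after [s]. *)
pose L := s ++ [seq x <- enum 'I_n | x \notin s].
have uL : uniq L.
  rewrite cat_uniq us filter_uniq ?enum_uniq // andbT /=.
  by apply/hasPn => x; rewrite mem_filter => /andP[].
have szL : size L = n.
  rewrite -[RHS](size_enum_ord n); apply/perm_size/uniq_perm => //.
    exact: enum_uniq.
  by move=> x; rewrite mem_cat mem_filter mem_enum andbT orbN.
pose f (x : 'I_n) := nth x L x.
have f_inj : injective f.
  move=> x y; rewrite /f (set_nth_default x y) ?szL // => /eqP.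
  by rewrite nth_uniq ?szL // => /eqP /val_inj.
move=> /(_ (perm f_inj)) /negbT /forallPn[x]; rewrite negb_imply permE /f.
by rewrite /L => /andP[xs]; rewrite nth_cat xs eqxx.
Qed.

Definition local_on (n : nat) (T : Type) (v : nat) (g : graph n -> T) : Prop :=
  forall G H, (forall i j : 'I_n, (i < v)%N -> (j < v)%N ->
    adj G i j = adj H i j) -> g G = g H.

Definition sym_mean (R : realType) (n : nat) (g : graph n -> R) (G : graph n) : R :=
  (\sum_(s : 'S_n) g (relabel s G)) / n`!%:R.

Lemma fact_neq0 (R : realType) (n : nat) : n`!%:R != 0 :> R.
Proof. by rewrite pnatr_eq0 -lt0n fact_gt0. Qed.

(** The fibres of [s |-> (s a, s b)] over the [n * n.-1] ordered pairs of distinct vertices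
    partition the group, and all have the same size. *)
Lemma card_perm_pair (n : nat) (a b c d : 'I_n) : a != b -> c != d ->
  (#|[set s : 'S_n | (s a == c) && (s b == d)]| * (n * n.-1))%N = n`!.
Proof.
move=> ab cd; pose X (e : 'I_n * 'I_n) := [set s : 'S_n | (s a == e.1) && (s b == e.2)].
pose D := [set e : 'I_n * 'I_n | e.1 != e.2].
have cardD : #|D| = (n * n.-1)%N.
  rewrite /D cardsE -sum1_card.
  rewrite (eq_bigl (fun e : 'I_n * 'I_n => xpredT e.1 && (e.2 != e.1))).
    rewrite -(pair_big_dep xpredT (fun i j : 'I_n => j != i) (fun _ _ => 1%N)) /=.
    under eq_bigr => i _ do rewrite sum1_card cardC1 card_ord.
    by rewrite sum_nat_const card_ord.
  by move=> e /=; rewrite unfold_in eq_sym.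
have leX c' d' e : c' != d' -> e.1 != e.2 -> (#|X (c', d')| <= #|X e|)%N.
  move=> cd' De.
  have u1 : uniq [:: c'; d'] by rewrite /= inE cd'.
  have u2 : uniq [:: e.1; e.2] by rewrite /= inE De.
  have i0 : (0 < n)%N by apply: leq_ltn_trans (leq0n _) (ltn_ord a).
  have i1 : (1 < n)%N.
    have := max_card (mem [:: a; b]); rewrite card_ord => /(leq_trans _); apply.
    by rewrite (card_uniqP _) //= inE ab.
  (* Right multiplication by [r], which takes [(c', d')] to [e], injects the fibre of the former
     into that of the latter. *)
  pose r := ((perm_of_seq [:: c'; d'])^-1 * perm_of_seq [:: e.1; e.2])%g.
  have rc : r c' = e.1.
    rewrite permM; have -> : (perm_of_seq [:: c'; d'])^-1%g c' = Ordinal i0.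
      by apply: (canLR (permK _)); rewrite (perm_of_seqE c).
    by rewrite (perm_of_seqE c).
  have rd : r d' = e.2.
    rewrite permM; have -> : (perm_of_seq [:: c'; d'])^-1%g d' = Ordinal i1.
      by apply: (canLR (permK _)); rewrite (perm_of_seqE c).
    by rewrite (perm_of_seqE c).
  rewrite -(card_imset _ (mulIg r)); apply/subset_leq_card/subsetP => t.
  case/imsetP => s; rewrite !inE /= => /andP[/eqP sa /eqP sb] ->.
  by rewrite !(permM s r) sa sb rc rd !eqxx.
rewrite -cardD mulnC -sum_nat_const.
transitivity (\sum_(e in D) #|X e|)%N.
  apply: eq_bigr => -[c' d']; rewrite inE => cd'.
  by apply/eqP; rewrite -[[set _ | _]]/(X (c, d)) eqn_leq; apply/andP; split; apply: leX.
under eq_bigr => e _ do rewrite /X cardsE -sum1_card.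
rewrite (exchange_big_dep xpredT) //=.
have -> : n`! = (\sum_(s : 'S_n) 1)%N by rewrite sum1_card card_Sn.
apply: eq_bigr => s _; rewrite sum1_card.
rewrite (@eq_card _ _ (pred1 (s a, s b))) ?card1 // => -[x y].
rewrite !inE /= unfold_in inE /= unfold_in xpair_eqE ![_ == s _]eq_sym.
case: (s a =P x) => [<-|_]; case: (s b =P y) => [<-|_]; rewrite ?andbF //.
by rewrite (inj_eq perm_inj) ab.
Qed.

Lemma leq_card_bigcup (T I : finType) (P : pred I) (A : I -> {set T}) :
  (#|\bigcup_(i | P i) A i| <= \sum_(i | P i) #|A i|)%N.
Proof.
elim/big_rec2: _ => [|i m B _ leB]; first by rewrite cards0.
by rewrite cardsU (leq_trans (leq_subr _ _)) // leq_add2l.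
Qed.

(** * Linearity and monotonicity of expectations *)

Lemma expectation_sum (R : realType) (X I : finType) (D : X -> R)
    (f : I -> X -> R) :
  expectation D (fun x => \sum_i f i x) = \sum_i expectation D (f i).
Proof.
rewrite /expectation exchange_big /=; apply: eq_bigr => x _.
by rewrite mulr_sumr.
Qed.

Lemma expectationZ (R : realType) (X : finType) (D f : X -> R) (r : R) :
  expectation D (fun x => r * f x) = r * expectation D f.
Proof.
by rewrite /expectation mulr_sumr; apply: eq_bigr => x _; rewrite mulrCA.
Qed.

Lemma eq_expectation (R : realType) (X : finType) (D f g : X -> R) :
  f =1 g -> expectation D f = expectation D g.
Proof. by move=> fg; apply: eq_bigr => x _; rewrite fg. Qed.

Lemma le_expectation (R : realType) (X : finType) (D f g : X -> R) :
  (forall x, 0 <= D x) -> (forall x, f x <= g x) ->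
  expectation D f <= expectation D g.
Proof. by move=> D0 fg; apply: ler_sum => x _; apply: ler_wpM2l. Qed.

Lemma expectation_cst (R : realType) (X : finType) (D : X -> R) (r : R) :
  \sum_x D x = 1 -> expectation D (fun=> r) = r.
Proof. by move=> D1; rewrite /expectation -mulr_suml D1 mul1r. Qed.

Section Variance.
Variables (R : realType) (n : nat) (p : R) (v : nat) (g : graph n -> R) (M : R).
Hypothesis p01 : 0 <= p <= 1.
Hypothesis gloc : local_on v g.
Hypothesis g0 : forall G, 0 <= g G.
Hypothesis gM : forall G, g G <= M.

(** [Q] contains both orientations of every pair among the first [v] vertices, so that [share s t]
    detects any unordered pair read by both copies of [g]. *)
Let Q := [set e : 'I_n * 'I_n | [&& (e.1 < v)%N, (e.2 < v)%N & e.1 != e.2]].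
Let share (s t : 'S_n) :=
  [exists e in Q, exists e' in Q, (t e'.1 == s e.1) && (t e'.2 == s e.2)].

Let card_Q : (#|Q| <= v ^ 2)%N.
Proof.
pose B := [set i : 'I_n | (i < v)%N].
have cB : (#|B| <= v)%N.
  rewrite cardE -(size_map val) -[X in (_ <= X)%N](size_iota 0).
  apply: uniq_leq_size; first by rewrite map_inj_uniq ?enum_uniq //; apply: val_inj.
  by move=> x /mapP[i]; rewrite mem_enum inE mem_iota => iv ->.
apply: (@leq_trans #|setX B B|); last by rewrite cardsX; apply: leq_mul.
apply/subset_leq_card/subsetP => -[x y]; rewrite !inE /=.
by move=> /and3P[-> ->].
Qed.

(** Union bound over at most [v ^ 4] choices of two pairs, each matched by a fraction
    [1 / (n * n.-1)] of the permutations. *)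
Let card_share s : (#|[set t | share s t]| * (n * n.-1) <= v ^ 4 * n`!)%N.
Proof.
pose X (e e' : 'I_n * 'I_n) := [set t : 'S_n | (t e'.1 == s e.1) && (t e'.2 == s e.2)].
have le1 : (#|[set t | share s t]| <= \sum_(e in Q) \sum_(e' in Q) #|X e e'|)%N.
  apply: (@leq_trans #|\bigcup_(e in Q) \bigcup_(e' in Q) X e e'|).
    apply/subset_leq_card/subsetP => t; rewrite inE => /exists_inP[e eQ].
    move=> /exists_inP[e' e'Q tt]; apply/bigcupP; exists e => //.
    by apply/bigcupP; exists e' => //; rewrite inE.
  apply: (leq_trans (leq_card_bigcup _ _)).
  by apply: leq_sum => e _; apply: leq_card_bigcup.
apply: (leq_trans (leq_mul le1 (leqnn _))).
rewrite big_distrl /=.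
apply: (@leq_trans (\sum_(e in Q) \sum_(e' in Q) n`!)%N).
  apply: leq_sum => e eQ; rewrite big_distrl /=; apply: leq_sum => e' e'Q.
  apply/eq_leq/card_perm_pair; first by move: e'Q; rewrite inE => /and3P[].
  by rewrite (inj_eq perm_inj); move: eQ; rewrite inE => /and3P[].
rewrite !sum_nat_const mulnA leq_mul2r; apply/orP; right.
by rewrite (expnD v 2 2); apply: leq_mul.
Qed.

Let E := expectation (@gnp R n p).
Let gs (s : 'S_n) G := g (relabel s G).

(** Copies that share no pair are independent and have covariance 0. For the others [0 <= g <= M]
    bounds the mean of the product by [M] times the mean of one factor. *)
Let cov_le s t :
  E (fun G => gs s G * gs t G) - E (gs s) * E (gs t) <= (share s t)%:R * (M * E (gs s)).
Proof.
have gnp0 G : 0 <= gnp p G by apply: gnp_ge0.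
have E0 u : 0 <= E (gs u) by apply: sumr_ge0 => G _; rewrite /gs mulr_ge0 ?gnp0 ?g0.
case: (boolP (share s t)) => [_|nsh]; last first.
  rewrite mul0r subr_le0 /E (@expectation_indep _ _ p
    (fun x y => [exists e in Q, (x == s e.1) && (y == s e.2)]) (gs s) (gs t)) //.
  - move=> x y; apply/exists_inP/exists_inP => -[e eQ /andP[xe ye]];
    exists (e.2, e.1); rewrite /= ?xe ?ye //; move: eQ; rewrite !inE /=;
    by rewrite eq_sym => /and3P[-> -> ->].
  - move=> G H GH; apply: gloc => i j iv jv; rewrite !adj_relabel.
    (* Diagonal positions are not in [Q], but there every graph is 0. *)
    have [->|ij] := eqVneq i j; first by rewrite !adj_irr.
    by apply: GH; apply/exists_inP; exists (i, j); rewrite ?inE ?eqxx //= iv jv.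
  - move=> G H GH; apply: gloc => i j iv jv; rewrite !adj_relabel.
    have [->|ij] := eqVneq i j; first by rewrite !adj_irr.
    apply: GH; apply: contra nsh => /exists_inP[e eQ tt].
    apply/exists_inP; exists e => //.
    by apply/exists_inP; exists (i, j); rewrite // inE /= iv jv.
rewrite mul1r.
apply: (@le_trans _ _ (E (fun G => gs s G * gs t G))).
  by rewrite lerBlDr lerDl; apply: mulr_ge0.
rewrite -expectationZ; apply: le_expectation => // G; rewrite mulrC.
by apply: ler_wpM2r; [exact: g0 | exact: gM].
Qed.

(** The variance is the average covariance over all [(s, t)]. By [cov_le] only sharing pairs
    contribute, and [card_share] bounds their number for each [s]; what remains is [M] times the
    mean, so the bound is linear in the mean. *)
Lemma variance_sym_mean : (1 < n)%N ->
  expectation (gnp p) (fun G => sym_mean g G ^+ 2) -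
    expectation (gnp p) (sym_mean g) ^+ 2 <=
  v%:R ^+ 4 / (n * n.-1)%:R * M * expectation (gnp p) (sym_mean g).
Proof.
move=> n1; have f0 := fact_neq0 R n.
have gnp0 G : 0 <= gnp p G by apply: gnp_ge0.
have E0 u : 0 <= E (gs u) by apply: sumr_ge0 => G _; rewrite /gs mulr_ge0 ?gnp0 ?g0.
have M0 : 0 <= M by apply: le_trans (g0 (graph_of_rel (fun _ _ => false))) (gM _).
have m1 : expectation (gnp p) (sym_mean g) = n`!%:R^-1 * \sum_s E (gs s).
  rewrite -expectation_sum -expectationZ; apply: eq_expectation => G.
  by rewrite /sym_mean mulrC.
have m2 : expectation (gnp p) (fun G => sym_mean g G ^+ 2) =
    n`!%:R^-1 ^+ 2 * \sum_s \sum_t E (fun G => gs s G * gs t G).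
  under eq_bigr => s _ do rewrite -expectation_sum.
  rewrite -expectation_sum -expectationZ; apply: eq_expectation => G.
  rewrite /sym_mean mulrC exprMn; congr (_ * _).
  by rewrite expr2 big_distrlr.
rewrite m2 m1 exprMn -mulrBr.
have -> : (\sum_s E (gs s)) ^+ 2 = \sum_s \sum_t E (gs s) * E (gs t).
  by rewrite expr2 big_distrlr.
rewrite -sumrB.
apply: (@le_trans _ _ (n`!%:R^-1 ^+ 2 *
   \sum_s (M * E (gs s)) * (v%:R ^+ 4 * n`!%:R / (n * n.-1)%:R))).
  apply: ler_wpM2l; first by rewrite exprn_ge0 // invr_ge0.
  apply: ler_sum => s _; rewrite -sumrB.
  apply: (@le_trans _ _ (\sum_t (share s t)%:R * (M * E (gs s)))).
    by apply: ler_sum => t _; apply: cov_le.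
  rewrite -mulr_suml mulrC; apply: ler_wpM2l; first exact: mulr_ge0.
  rewrite ler_pdivlMr; last by rewrite ltr0n; case: (n) n1 => [|[]].
  have := card_share s; rewrite -(ler_nat R) (natrM _ (v ^ 4)) natrX.
  apply: le_trans; rewrite [X in _ <= X]natrM; apply: ler_wpM2r => //.
  by rewrite -natr_sum -big_mkcond /= sum1_card cardsE.
rewrite -mulr_suml -mulr_sumr le_eqVlt; apply/orP; left; apply/eqP.
have nn : (n * n.-1)%:R != 0 :> R by rewrite pnatr_eq0; case: (n) n1 => [|[]].
move: nn f0; move: (n * n.-1)%:R n`!%:R => x y nn f0.
by field; rewrite nn f0.
Qed.

End Variance.

(** * Circuits *)

Lemma size_wire_values (x : seq bool) (gs : seq gate) :
  size (wire_values x gs) = (size x + size gs)%N.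
Proof.
elim/last_ind: gs => [|gs g IH]; first by rewrite addn0.
by rewrite /wire_values foldl_rcons !size_rcons IH addnS.
Qed.

Lemma size_wire_depths (N : nat) (gs : seq gate) :
  size (wire_depths N gs) = (N + size gs)%N.
Proof.
elim/last_ind: gs => [|gs g IH]; first by rewrite addn0 /= size_nseq.
by rewrite /wire_depths foldl_rcons !size_rcons IH addnS.
Qed.

Lemma eq_gate_eval (v w : seq bool) (g : gate) :
  {in gate_args g, nth false v =1 nth false w} -> gate_eval v g = gate_eval w g.
Proof.
case: g => [s|s|i] /= vw; [exact: eq_in_all|exact: eq_in_has|].
by rewrite vw // mem_head.
Qed.

(** Induction on the gates: a gate of depth [t + 1] has at most [k] arguments, each determined by at
    most [k ^ t] inputs. [S] may have repetitions, as only its length is counted. *)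
Lemma wire_junta (N k : nat) (gs : seq gate) : (0 < k)%N ->
  all (fun g => size (gate_args g) <= k)%N gs ->
  forall i, exists2 S : seq nat,
    (size S <= k ^ nth 0%N (wire_depths N gs) i)%N &
    forall x y : seq bool, size x = N -> size y = N ->
      {in S, nth false x =1 nth false y} ->
      nth false (wire_values x gs) i = nth false (wire_values y gs) i.
Proof.
move=> k0; elim/last_ind: gs => [_ i|gs g IH].
  exists [:: i]; first by rewrite expn_gt0 k0.
  by move=> x y _ _; apply; rewrite mem_head.
rewrite all_rcons => /andP[gk /IH {}IH] i.
have [il|il|il] := ltngtP i (N + size gs)%N.
- have [S Ss Sp] := IH i; exists S.
    by rewrite /wire_depths foldl_rcons nth_rcons size_wire_depths il.
  move=> x y sx sy xy; rewrite /wire_values !foldl_rcons !nth_rcons.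
  by rewrite !size_wire_values sx sy il; apply: Sp.
(* Beyond the last wire both sides are the default value. *)
- exists [::] => // x y sx sy _; rewrite /wire_values !foldl_rcons !nth_rcons.
  by rewrite !size_wire_values sx sy ltnNge (ltnW il) /= gtn_eqF.
pose D := \max_(j <- gate_args g) nth 0%N (wire_depths N gs) j.
have [S Ss Sp] : exists2 S : seq nat, (size S <= size (gate_args g) * k ^ D)%N &
    forall x y : seq bool, size x = N -> size y = N ->
      {in S, nth false x =1 nth false y} ->
      {in gate_args g, nth false (wire_values x gs) =1 nth false (wire_values y gs)}.
  have : forall j, j \in gate_args g -> (nth 0%N (wire_depths N gs) j <= D)%N.
    by move=> j jg; rewrite /D (big_rem j) //= leq_maxl.
  move: D => D; elim: (gate_args g) => [|j s IHs] sD; first by exists [::].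
  have [|S Ss Sp] := IHs; first by move=> j' js; apply: sD; rewrite inE js orbT.
  have [S' Ss' Sp'] := IH j; exists (S' ++ S).
    rewrite size_cat mulSn leq_add // (leq_trans Ss') //.
    by rewrite leq_pexp2l // sD // mem_head.
  move=> x y sx sy xy j'; rewrite inE => /predU1P[->|j's].
    by apply: Sp' => // e eS; apply: xy; rewrite mem_cat eS.
  by apply: Sp => // e eS; apply: xy; rewrite mem_cat eS orbT.
exists S.
  rewrite /wire_depths foldl_rcons nth_rcons size_wire_depths il ltnn eqxx.
  by rewrite (leq_trans Ss) // expnS leq_mul2r gk orbT.
move=> x y sx sy xy; rewrite /wire_values !foldl_rcons !nth_rcons.
rewrite !size_wire_values sx sy il ltnn eqxx.
by apply: eq_gate_eval; apply: Sp.
Qed.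

Lemma nth_map_eq (T : eqType) (f h : T -> bool) (s : seq T) (i : nat) :
  uniq s -> (forall e, e \in s -> index e s = i -> f e = h e) ->
  nth false (map f s) i = nth false (map h s) i.
Proof.
move=> us fh; have [si|si] := ltnP i (size s); last first.
  by rewrite !nth_default ?size_map.
have [x0 _] : exists x0 : T, true by case: (s) si => // x; exists x.
by rewrite !(nth_map x0) //; apply: fh; rewrite ?mem_nth ?index_uniq.
Qed.

Lemma val_graph_bits (n : nat) (G : graph n) :
  graph_bits G = [seq adj G e.1 e.2 | e <- vpairs n] :> seq bool.
Proof. by rewrite /graph_bits val_tcast. Qed.

Definition junta_on (n : nat) (S : {set 'I_n * 'I_n}) (f : graph n -> bool) : Prop :=
  forall G H, (forall e, e \in S -> adj G e.1 e.2 = adj H e.1 e.2) -> f G = f H.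

Lemma circuit_junta (n m k d : nat) (C : circuit 'C(n, 2) m) (j : 'I_m) :
  (0 < k)%N -> fanin_at_most C k -> depth_at_most C d ->
  exists S : {set 'I_n * 'I_n},
    [/\ (#|S| <= k ^ d)%N, forall e, e \in S -> (e.1 < e.2)%N &
        junta_on S (fun G => tnth (circuit_eval C (graph_bits G)) j)].
Proof.
move=> k0 Ck Cd.
have [S Ss Sp] := wire_junta 'C(n, 2) k0 Ck (tnth (outputs C) j).
pose S' := [set e in vpairs n | index e (vpairs n) \in S].
have uv : uniq (vpairs n) by rewrite filter_uniq // enum_uniq.
exists S'; split => [|e|G H GH].
- apply: (@leq_trans (size S)).
    rewrite cardE -(size_map (index^~ (vpairs n))); apply: uniq_leq_size.
      rewrite map_inj_in_uniq ?enum_uniq // => e e'.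
      rewrite !mem_enum !inE => /andP[ev _] /andP[ev' _] ee'.
      by rewrite -(nth_index e ev) ee' nth_index.
    by move=> i /mapP[e]; rewrite mem_enum inE => /andP[_ eS] ->.
  apply: (leq_trans Ss); rewrite leq_pexp2l //.
  (* An index past the last wire has default depth 0, which is also at most [d]. *)
  have [il|il] := ltnP (tnth (outputs C) j) (size (wire_depths 'C(n, 2) (gates C))).
    by move/all_nthP: Cd; apply.
  by rewrite nth_default.
- by rewrite inE mem_filter => /andP[/andP[]].
rewrite /circuit_eval !tnth_map; apply: Sp; rewrite ?size_tuple //.
move=> i iS; rewrite !val_graph_bits; apply: nth_map_eq => // e ev ei.
by apply: GH; rewrite inE ev ei.
Qed.

(** The pairs of [S] touch a list [V] of at most [2 * K] vertices; the inverse of a permutation that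
    starts with [V] moves them to the first labels. *)
Lemma junta_relabel (n K : nat) (S : {set 'I_n * 'I_n}) (f : graph n -> bool) :
  (#|S| <= K)%N -> junta_on S f ->
  exists t : 'S_n, local_on (2 * K) (fun G => f (relabel t G)).
Proof.
move=> SK fS.
pose V := undup (flatten [seq [:: e.1; e.2] | e <- enum S]).
have uV : uniq V by apply: undup_uniq.
have sV : (size V <= 2 * K)%N.
  apply: (leq_trans (size_undup _)); rewrite size_flatten /shape -map_comp.
  apply: (@leq_trans (2 * #|S|)); last by rewrite leq_mul2l.
  rewrite cardE; elim: (enum S) => //= e s IH.
  by rewrite mulnS leq_add2l.
have VS e : e \in S -> (e.1 \in V) && (e.2 \in V).
  move=> eS; rewrite !mem_undup; apply/andP; split; apply/flatten_mapP;
  by exists e; rewrite ?mem_enum // !inE eqxx ?orbT.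
have sVn : (size V <= n)%N.
  by rewrite -[X in (_ <= X)%N]card_ord -(card_uniqP uV) max_card.
have Vt u : u \in V -> ((perm_of_seq V)^-1%g u < 2 * K)%N.
  move=> uin; have iu : (index u V < n)%N.
    by apply: leq_trans sVn; rewrite index_mem.
  have -> : (perm_of_seq V)^-1%g u = Ordinal iu.
    apply: (canLR (permK _)); rewrite (perm_of_seqE u) //= ?index_mem //.
    by rewrite nth_index.
  by rewrite /= (leq_trans _ sV) // index_mem.
exists ((perm_of_seq V)^-1)%g => G H GH; apply: fS => e /VS /andP[e1 e2].
by rewrite !adj_relabel; apply: GH; apply: Vt.
Qed.

(** Translation by [t] permutes the group. Hence each output of the circuit may be relabelled by its
    own permutation without changing the average of the sum. *)
Lemma sym_mean_relabel (R : realType) (n : nat) (g : graph n -> R) (t : 'S_n) G :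
  sym_mean (fun H => g (relabel t H)) G = sym_mean g G.
Proof.
rewrite /sym_mean; congr (_ / _); rewrite [RHS](reindex_inj (mulgI t)) /=.
by apply: eq_bigr => s _; rewrite relabelM.
Qed.

Lemma sum_NC0_sym_mean (R : realType) (k d a n : nat) (F : graph n -> nat) :
  (0 < k)%N -> graph_parameter F -> sum_NC0 k d a F ->
  exists (M : nat) (g : graph n -> nat),
    [/\ (M <= a * 'C(n, 2) ^ a + a)%N, forall G, (g G <= M)%N,
        local_on (2 * k ^ d) g,
        forall G, (F G)%:R = sym_mean (fun H => (g H)%:R) G :> R &
        forall p r : R, 0 <= r <= 1 -> r <= p -> r <= 1 - p ->
          M%:R * r ^+ (k ^ d) <= expectation (gnp p) (fun G => (F G)%:R)].
Proof.
move=> k0 Finv [m [C [ma Ck Cd FE]]].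
pose f (j : 'I_m) G := tnth (circuit_eval C (graph_bits G)) j.
have {}FE G : F G = (\sum_j f j G)%N by rewrite FE.
have fj j := circuit_junta j k0 Ck Cd.
have /fin_all_exists[t tP] : forall j, exists t : 'S_n,
    local_on (2 * k ^ d) (fun G => f j (relabel t G)).
  move=> j; have [S [SK _ Sj]] := fj j.
  exact: junta_relabel SK Sj.
(* Counting only the outputs with a satisfying graph makes [M] comparable with the mean of [F],
   while the other outputs add nothing to [g]. *)
pose nz j := [exists G, f j G].
exists (\sum_j nz j)%N, (fun G => \sum_j f j (relabel (t j) G))%N; split.
- apply: leq_trans ma; rewrite -[X in (_ <= X)%N]card_ord -sum1_card.
  by apply: leq_sum => j _; case: nz.
- move=> G; apply: leq_sum => j _; rewrite /nz.
  by case: existsP => [_|nex]; [case: (f _ _)|case: (boolP (f _ _)) => // fG; case: nex; eexists; exact: fG].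
- by move=> G H GH; apply: eq_bigr => j _; rewrite (tP j G H).
- move=> G.
  transitivity (\sum_j sym_mean (fun H => (f j (relabel (t j) H))%:R : R) G).
    under eq_bigr => j _ do rewrite (sym_mean_relabel (fun H => (f j H)%:R)).
    rewrite /sym_mean -mulr_suml exchange_big /=.
    under eq_bigr => s _ do rewrite -natr_sum -FE.
    rewrite (eq_bigr (fun=> (F G)%:R)); last first.
      by move=> s _; congr _%:R; apply: (Finv s) => i j; apply: adj_relabel.
    rewrite sumr_const card_Sn -[X in X / _]mulr_natr mulfK //.
    exact: fact_neq0.
  rewrite /sym_mean -mulr_suml exchange_big /=.
  by under eq_bigr => s _ do rewrite -natr_sum.
move=> p r r01 rp rq.
rewrite (@eq_expectation _ _ _ _ (fun G => \sum_j (f j G)%:R)); last first.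
  by move=> G; rewrite FE natr_sum.
rewrite expectation_sum natr_sum mulr_suml; apply: ler_sum => j _.
have p01 : 0 <= p <= 1 by case/andP: r01; lra.
rewrite /nz; case: existsP => [[G0 fG0]|_]; last first.
  by rewrite mul0r; apply: sumr_ge0 => G _; rewrite mulr_ge0 // gnp_ge0.
rewrite mul1r; have [S [SK Slt Sj]] := fj j.
apply: (le_trans (prob_agree_ge G0 r01 rp rq SK Slt)).
rewrite big_mkcond; apply: ler_sum => G _.
case: ifP => [/forall_inP ag|_]; last by rewrite mulr_ge0 // gnp_ge0.
have -> : f j G = f j G0 by apply: Sj => e /ag /eqP.
by rewrite fG0 mulr1.
Qed.

(** * Concentration or gaps *)

Lemma chebyshev (R : realType) (X : finType) (D f : X -> R) (t mu e : R) :
  (forall x, 0 <= D x) -> \sum_x D x = 1 -> 0 < t ->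
  expectation D f = mu -> expectation D (fun x => f x ^+ 2) - mu ^+ 2 <= e * t ^+ 2 ->
  1 - e <= prob D (fun x => `|f x - mu| <= t).
Proof.
move=> D0 D1 t0 Emu var.
have -> : prob D (fun x => `|f x - mu| <= t) =
    1 - \sum_(x | ~~ (`|f x - mu| <= t)) D x.
  by rewrite -D1 (bigID (fun x => `|f x - mu| <= t)) /= addrK.
rewrite lerD2l lerN2 -(ler_pM2r (exprn_gt0 2 t0)).
apply: le_trans var.
have -> : expectation D (fun x => f x ^+ 2) - mu ^+ 2 =
    \sum_x D x * (f x - mu) ^+ 2.
  transitivity (expectation D (fun x => f x ^+ 2) - 2 * mu * expectation D f
     + mu ^+ 2 * \sum_x D x); first by rewrite D1 Emu; ring.
  rewrite /expectation !mulr_sumr -sumrB -big_split /=.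
  by apply: eq_bigr => x _; ring.
rewrite mulr_suml big_mkcond; apply: ler_sum => x _.
case: ifPn => [|_]; last by rewrite mulr_ge0 // sqr_ge0.
rewrite -ltNge => tx; apply: ler_wpM2l => //.
by rewrite -(real_normK (num_real (f x - mu))) lerXn2r ?nnegrE // ltW.
Qed.

Lemma prob_gt0_ex (R : realType) (X : finType) (D : X -> R) (P : pred X) :
  0 < prob D P -> exists x, P x.
Proof.
move=> P0; apply/existsP; apply: contraLR P0 => /existsPn nP.
by rewrite /prob big_pred0 ?ltxx // => x; apply: negbTE.
Qed.

(** What an estimate of [rho] with error below [gam / 2] needs in order to decide: an interval of
    mass 9/10 from which every value to be rejected is [gam] away. The bounds by [1 + eps] keep the
    thresholds bounded. *)
Definition gap (R : realType) (X : finType) (D rho : X -> R) (eps lo hi gam : R) : Prop :=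
  [/\ 0 <= hi, lo <= 1 + eps, hi <= 1 + eps,
      9 / 10 <= prob D (fun x => lo <= rho x <= hi) &
      forall x, eps < `|rho x - 1| -> rho x <= lo - gam \/ hi + gam <= rho x].

(** Chebyshev at distance [eps / 2]: the mass outside is at most
    [(eps ^ 2 / 40) / (eps / 2) ^ 2 = 1 / 10]. *)
Lemma gap_concentrated (R : realType) (X : finType) (D rho : X -> R) (eps gam : R) :
  (forall x, 0 <= D x) -> \sum_x D x = 1 -> 0 < eps -> gam <= eps / 2 ->
  expectation D rho = 1 ->
  expectation D (fun x => rho x ^+ 2) - 1 <= eps ^+ 2 / 40 ->
  gap D rho eps (1 - eps / 2) (1 + eps / 2) gam.
Proof.
move=> D0 D1 e0 ge E1 var.
have t0 : 0 < eps / 2 by lra.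
have var' : expectation D (fun x => rho x ^+ 2) - 1 ^+ 2 <= 1 / 10 * (eps / 2) ^+ 2.
  by rewrite expr1n (le_trans var) // le_eqVlt; apply/orP; left; apply/eqP; field.
split; try lra.
- apply: (@le_trans _ _ (prob D (fun x => `|rho x - 1| <= eps / 2))).
    by apply: le_trans (chebyshev D0 D1 t0 E1 var'); lra.
  rewrite /prob le_eqVlt; apply/orP; left; apply/eqP/eq_bigl => x.
  by rewrite ler_distl.
- move=> x; rewrite ltr_normr => /orP[h|h]; [right|left]; lra.
Qed.

(** Take for [lo] and [hi] the least and greatest values of [rho] within [eps] of 1. A value to be
    rejected lies strictly outside, hence [gam] away from the nearer end. *)
Lemma gap_spaced (R : realType) (X : finType) (D rho : X -> R) (eps gam : R) :
  (forall x, 0 <= rho x) -> qc_promise D rho eps ->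
  (forall x y, rho x != rho y -> gam <= `|rho x - rho y|) ->
  exists lo hi, gap D rho eps lo hi gam.
Proof.
move=> r0 prom sp.
have [x0 Px0] : exists x, `|rho x - 1| <= eps.
  by apply: (@prob_gt0_ex _ _ D); apply: lt_le_trans prom; lra.
pose P x := `|rho x - 1| <= eps.
have [xm Pm xmP] := @arg_minP _ R X x0 P rho Px0.
have [xM PM xMP] := @arg_maxP _ R X x0 P rho Px0.
move: (Pm); rewrite /P ler_distl => /andP[m1 m2].
move: (PM); rewrite /P ler_distl => /andP[M1 M2].
exists (rho xm), (rho xM); split => //; try lra.
- apply: le_trans prom _; rewrite /prob [leRHS]big_mkcond [leLHS]big_mkcond.
  rewrite le_eqVlt; apply/orP; left; apply/eqP; apply: eq_bigr => x _.
  have [Px|nPx] := boolP (P x); first by rewrite -/(P x) Px xmP //=; have := xMP x Px; rewrite /= => ->.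
  rewrite -/(P x) (negbTE nPx); case: ifP => // /andP[h1 h2].
  by case/negP: nPx; rewrite /P ler_distl; lra.
move=> x; rewrite ltr_normr => /orP[h|h].
  have gt : rho xM < rho x by lra.
  right; have := sp x xM; rewrite gt_eqF // gtr0_norm ?subr_gt0 //.
  by move/(_ isT); lra.
have lt : rho x < rho xm by lra.
left; have := sp x xm; rewrite lt_eqF // ltr0_norm ?subr_lt0 //.
by move/(_ isT); lra.
Qed.

(** Raising the bound on [p] to the power [2 * K - 1] removes the real exponent. *)
Lemma powR_root_bound (R : realType) (K n : nat) (c p : R) :
  (0 < K)%N -> (0 < n)%N -> 0 < c ->
  c / n%:R `^ (2 / (2 * K%:R - 1)) <= p ->
  0 < p /\ c ^+ (2 * K).-1 <= n%:R ^+ 2 * p ^+ (2 * K).-1.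
Proof.
move=> K0 n0 c0 cp; set y := n%:R `^ _ in cp.
have y0 : 0 < y by rewrite powR_gt0 // ltr0n.
have p0 : 0 < p by apply: lt_le_trans cp; apply: divr_gt0.
split => //.
have eq1 : 2 * K%:R - 1 = (2 * K).-1%:R :> R.
  by rewrite -subn1 natrB ?muln_gt0 // natrM.
have q0 : (2 * K).-1%:R != 0 :> R by rewrite pnatr_eq0; lia.
have yq : y ^+ (2 * K).-1 = n%:R ^+ 2.
  by rewrite -powR_mulrn ?ltW // /y -powRrM eq1 divfK // powR_mulrn.
rewrite -yq -exprMn; apply: lerXn2r.
- by rewrite nnegrE ltW.
- by rewrite nnegrE ltW // mulr_gt0.
by rewrite [y * p]mulrC -ler_pdivrMr.
Qed.

Lemma expectation_div (R : realType) (X : finType) (D f : X -> R) (r : R) :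
  expectation D (fun x => f x / r) = expectation D f / r.
Proof. by rewrite mulrC -expectationZ; apply: eq_expectation => x; rewrite mulrC. Qed.

Lemma gnp_edge (R : realType) (n : nat) (p : R) (x y : 'I_n) : x != y ->
  expectation (gnp p) (fun G => (adj G x y)%:R) = p.
Proof.
wlog xy : x y / (x < y)%N.
  move=> IH; case: (ltngtP x y) => [xy|xy|/val_inj ->]; last by rewrite eqxx.
    exact: IH.
  move=> ne; rewrite -[RHS](IH y x) // 1?eq_sym //.
  by apply: eq_expectation => G; rewrite adj_sym.
move=> _; pose G0 : graph n := graph_of_rel (fun _ _ => true).
have Slt (e : 'I_n * 'I_n) : e \in [set (x, y)] -> (e.1 < e.2)%N.
  by rewrite inE => /eqP ->.
have := prob_agree p G0 Slt.
rewrite big_set1 [adj G0 _ _]mxE xy /edge_weight => agr; rewrite -[RHS]agr.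
rewrite /expectation [RHS]big_mkcond; apply: eq_bigr => G _.
have -> : [forall e in [set (x, y)], adj G e.1 e.2 == adj G0 e.1 e.2] = adj G x y.
  apply/forall_inP/idP => [/(_ (x, y))|a e]; rewrite inE.
    by rewrite eqxx /= mxE xy => /(_ isT)/eqP.
  by move=> /eqP -> /=; rewrite mxE xy a.
by case: (adj G x y); rewrite ?mulr1 ?mulr0.
Qed.

(** [(s x, s y)] is uniform over ordered pairs of distinct vertices, so the average is the edge
    density; each edge is counted in both orientations. *)
Lemma sym_mean_edge (R : realType) (n : nat) (x y : 'I_n) (G : graph n) : x != y ->
  sym_mean (fun H => (adj H x y)%:R : R) G =
  #|[set e : 'I_n * 'I_n | adj G e.1 e.2]|%:R / (n * n.-1)%:R.
Proof.
move=> xy; have n1 : (1 < n)%N.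
  have := max_card (mem [:: x; y]); rewrite card_ord => /(leq_trans _); apply.
  by rewrite (card_uniqP _) //= inE xy.
have nn0 : (n * n.-1)%:R != 0 :> R by rewrite pnatr_eq0; lia.
have f0 := fact_neq0 R n.
rewrite /sym_mean; apply/eqP; rewrite eqr_div // -natr_sum -!natrM; apply/eqP.
congr _%:R.
transitivity ((\sum_(e : 'I_n * 'I_n | adj G e.1 e.2)
   #|[set s : 'S_n | (s x == e.1) && (s y == e.2)]|) * (n * n.-1))%N.
  congr muln; under [RHS]eq_bigr => e _ do rewrite cardsE -sum1_card.
  rewrite [RHS](exchange_big_dep xpredT) //=; apply: eq_bigr => s _.
  rewrite adj_relabel sum1_card; case: (boolP (adj G (s x) (s y))) => a.
    symmetry; apply: (@eq_card1 _ (s x, s y)) => -[u w].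
    rewrite !unfold_in /=. rewrite xpair_eqE ![_ == s _]eq_sym.
    by case: (s x =P u) => [<-|_]; case: (s y =P w) => [<-|_]; rewrite ?andbF // a.
  symmetry; apply: eq_card0 => -[u w]; rewrite !unfold_in /=.
  case: (s x =P u) => [<-|_]; case: (s y =P w) => [<-|_]; rewrite ?andbF //.
  by rewrite (negbTE a).
rewrite big_distrl /= (eq_bigr (fun=> n`!)); last first.
  move=> e a; apply: card_perm_pair => //.
  by apply: contraTneq a => ->; rewrite adj_irr.
by rewrite sum_nat_const cardsE.
Qed.

Lemma variance_affine (R : realType) (X : finType) (D f : X -> R) (u w : R) :
  \sum_x D x = 1 ->
  expectation D (fun x => (u + w * f x) ^+ 2) - expectation D (fun x => u + w * f x) ^+ 2 =
  w ^+ 2 * (expectation D (fun x => f x ^+ 2) - expectation D f ^+ 2).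
Proof.
move=> D1.
have -> : expectation D (fun x => u + w * f x) = u + w * expectation D f.
  have {2}-> : u = \sum_x D x * u by rewrite -mulr_suml D1 mul1r.
  rewrite /expectation !mulr_sumr -big_split /=.
  by apply: eq_bigr => x _; ring.
have -> : expectation D (fun x => (u + w * f x) ^+ 2) =
    u ^+ 2 + 2 * u * w * expectation D f + w ^+ 2 * expectation D (fun x => f x ^+ 2).
  have -> : u ^+ 2 = \sum_x D x * u ^+ 2 by rewrite -mulr_suml D1 mul1r.
  rewrite /expectation !mulr_sumr -!big_split /=.
  by apply: eq_bigr => x _; ring.
ring.
Qed.

Lemma rho_param_ge0 (R : realType) (n : nat) (p : R) (F : graph n -> nat) G :
  0 < expectation (gnp p) (fun G => (F G)%:R) -> 0 <= rho_param p F G.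
Proof. by move=> EF0; rewrite divr_ge0 // ltW. Qed.

Lemma expectation_rho_param (R : realType) (n : nat) (p : R) (F : graph n -> nat) :
  0 < expectation (gnp p) (fun G => (F G)%:R) ->
  expectation (gnp p) (rho_param p F) = 1.
Proof. by move=> EF0; rewrite expectation_div divff // gt_eqF. Qed.

Lemma variance_rho_param (R : realType) (n v M : nat) (p : R) (F g : graph n -> nat) :
  (1 < n)%N -> 0 <= p <= 1 -> local_on v g -> (forall G, (g G <= M)%N) ->
  (forall G, (F G)%:R = sym_mean (fun H => (g H)%:R) G :> R) ->
  0 < expectation (gnp p) (fun G => (F G)%:R) ->
  expectation (gnp p) (fun G => rho_param p F G ^+ 2) - 1 <=
  v%:R ^+ 4 / (n * n.-1)%:R * M%:R / expectation (gnp p) (fun G => (F G)%:R).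
Proof.
move=> n1 p01 gl gM FE EF0.
have gl' : local_on v (fun H => (g H)%:R : R).
  by move=> G H GH; rewrite (gl G H).
have g0' G : 0 <= (g G)%:R :> R by [].
have gM' G : (g G)%:R <= M%:R :> R by rewrite ler_nat.
have := variance_sym_mean p01 gl' g0' gM' n1.
have EE : expectation (gnp p) (fun G => (F G)%:R) =
    expectation (gnp p) (sym_mean (fun H => (g H)%:R)).
  exact: eq_expectation.
rewrite -EE.
have -> : expectation (gnp p) (fun G => sym_mean (fun H => (g H)%:R) G ^+ 2) =
   expectation (gnp p) (fun G => (F G)%:R ^+ 2).
  by apply: eq_expectation => G; rewrite FE.
have -> : expectation (gnp p) (fun G => rho_param p F G ^+ 2) =
   expectation (gnp p) (fun G => (F G)%:R ^+ 2) /
     expectation (gnp p) (fun G => (F G)%:R) ^+ 2.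
  by rewrite -expectation_div; apply: eq_expectation => G; rewrite expr_div_n.
move: EF0 {EE}; set m := expectation _ (fun G => (F G)%:R).
set m2 := expectation _ _; set A := v%:R ^+ 4 / _ * _ => m0 var.
have -> : m2 / m ^+ 2 - 1 = (m2 - m ^+ 2) / m ^+ 2 by field; rewrite gt_eqF.
rewrite ler_pdivrMr ?exprn_gt0 //; apply: (le_trans var).
by rewrite expr2 mulrA divfK // gt_eqF.
Qed.

Lemma expectation_sym_edge (R : realType) (n : nat) (p : R) (x y : 'I_n) :
  x != y -> expectation (gnp p) (sym_mean (fun H => (adj H x y)%:R)) = p.
Proof.
move=> xy; rewrite expectation_div expectation_sum.
rewrite (eq_bigr (fun=> p)); last first.
  move=> s _; rewrite -[RHS](@gnp_edge R n p (s x) (s y)) ?(inj_eq perm_inj) //.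
  by apply: eq_expectation => G; rewrite adj_relabel.
by rewrite sumr_const card_Sn -[X in X / _]mulr_natr mulfK // fact_neq0.
Qed.

(* The case [k ^ d = 1]: [F] is an affine function of the number of edges, hence
   it is either concentrated or takes well-spaced values. *)
Lemma gap_single_edge (R : realType) (n : nat) (p eps s0 B : R) (F g : graph n -> nat) :
  (1 < n)%N -> 0 <= p <= 1 -> 0 < eps -> 0 < s0 <= 1 -> s0 <= eps / 2 ->
  local_on 2 g ->
  (forall G, (F G)%:R = sym_mean (fun H => (g H)%:R) G :> R) ->
  0 < expectation (gnp p) (fun G => (F G)%:R) ->
  qc_promise (gnp p) (rho_param p F) eps ->
  (n * n.-1)%:R * p <= B -> 16 * s0 * B <= eps ^+ 2 / 40 ->
  exists lo hi, gap (gnp p) (rho_param p F) eps lo hi s0.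
Proof.
move=> n1 p01 e0 /andP[s00 s01] se gl FE EF0 prom nB sB.
have gnp0 G : 0 <= gnp p G by apply: gnp_ge0.
have n0 : (0 < n)%N by apply: ltnW.
pose x : 'I_n := Ordinal n0; pose y : 'I_n := Ordinal n1.
have xy : x != y by [].
pose e0g : graph n := graph_of_rel (fun _ _ => false).
pose e1g : graph n := graph_of_rel (fun _ _ => true).
pose g0 : R := (g e0g)%:R; pose b : R := (g e1g)%:R - g0.
pose X (G : graph n) : R := sym_mean (fun H => (adj H x y)%:R) G.
have glE G H : adj G x y = adj H x y -> g G = g H.
  move=> GH; apply: gl => i j i2 j2.
  have cs (u : 'I_n) : (u < 2)%N -> u = x \/ u = y.
    by case: u => -[|[|//]] ui _; [left|right]; apply: val_inj.
  have [->|->] := cs i i2; have [->|->] := cs j j2; rewrite ?adj_irr //.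
  by rewrite adj_sym GH adj_sym.
have gE G : (g G)%:R = g0 + b * (adj G x y)%:R :> R.
  rewrite /b; have [a|a] := boolP (adj G x y).
    by rewrite (glE G e1g) ?mxE // mulr1 addrC subrK.
  by rewrite (glE G e0g) ?mxE ?(negbTE a) // mulr0 addr0.
set m := expectation _ _ in EF0.
have FX G : (F G)%:R = g0 + b * X G.
  rewrite FE /X /sym_mean; under eq_bigr => s _ do rewrite gE.
  rewrite big_split /= sumr_const card_Sn -mulr_sumr mulrDl mulrA; congr (_ + _).
  by rewrite -[X in X / _]mulr_natr mulfK // fact_neq0.
have rX G : rho_param p F G = g0 / m + b / m * X G.
  by rewrite /rho_param -/m FX mulrDl mulrAC.
have [D DE] : exists D : R, D = (n * n.-1)%:R by eexists.
rewrite -DE in nB.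
have D0 : 0 < D by rewrite DE ltr0n; lia.
(* The change of [rho_param] when the number of ordered edges changes by 1. *)
pose s := `|b| / (D * m).
have s_ge0 : 0 <= s by rewrite divr_ge0 // mulr_ge0 // ltW.
(* If [s0 <= s], the values are spaced because edge counts are integers. Otherwise the slope is so
   small that the variance is at most [eps ^ 2 / 40]. *)
have [ss0|ss0] := ltP s s0; last first.
  apply: gap_spaced => // [G|G H]; first exact: rho_param_ge0.
  rewrite !rX /X !sym_mean_edge // -DE => ne; apply: (le_trans ss0).
  set u := #|_|; set w := #|_|.
  have -> : g0 / m + b / m * (u%:R / D) - (g0 / m + b / m * (w%:R / D)) =
      b / (D * m) * (u%:R - w%:R) by field; rewrite (gt_eqF D0) (gt_eqF EF0).
  have uw : u != w by apply: contraNneq ne => uw; rewrite -/u -/w uw.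
  rewrite normrM normrM normrV ?unitfE ?gt_eqF ?mulr_gt0 //.
  rewrite (gtr0_norm (mulr_gt0 D0 EF0)) -/s ler_peMr //.
  wlog: u w uw {ne} / (w < u)%N.
    move=> IH; case: (ltngtP w u) => [wu|uw'|/esym/eqP]; last by rewrite (negbTE uw).
      exact: IH.
    by rewrite distrC; apply: IH; rewrite // eq_sym.
  by move=> wu; rewrite -natrB ?(ltnW wu) // normr_nat ler1n subn_gt0.
exists (1 - eps / 2), (1 + eps / 2); apply: gap_concentrated => //.
- exact: gnp_sum1.
- exact: expectation_rho_param.
have E1 := expectation_rho_param EF0.
have -> : expectation (gnp p) (fun G => rho_param p F G ^+ 2) - 1 =
    (b / m) ^+ 2 * (expectation (gnp p) (fun G => X G ^+ 2) - expectation (gnp p) X ^+ 2).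
  rewrite -(variance_affine X (g0 / m)) ?gnp_sum1 //; congr (_ - _).
    by apply: eq_expectation => G; rewrite rX.
  rewrite (@eq_expectation _ _ _ _ (rho_param p F)); last by move=> G; rewrite rX.
  by rewrite E1 expr1n.
(* [variance_sym_mean] with [v = 2] and [M = 1], whence the constant [16 = 2 ^ 4]. *)
have varX : expectation (gnp p) (fun G => X G ^+ 2) - expectation (gnp p) X ^+ 2 <=
    16 / D * p.
  have := @variance_sym_mean R n p 2 (fun H => (adj H x y)%:R) 1 p01.
  rewrite -DE expectation_sym_edge // mulr1 -natrX; apply => //.
  - by move=> G H GH; rewrite GH.
  - by move=> G; case: (adj G x y).
apply: (@le_trans _ _ ((b / m) ^+ 2 * (16 / D * p))).
  by apply: ler_wpM2l => //; apply: sqr_ge0.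
have -> : (b / m) ^+ 2 * (16 / D * p) = 16 * s ^+ 2 * (D * p).
  rewrite /s !expr_div_n (real_normK (num_real b)).
  by field; rewrite (gt_eqF D0) (gt_eqF EF0).
apply: le_trans sB.
have B0 : 0 <= B by apply: le_trans nB; rewrite mulr_ge0 ?(ltW D0) //; case/andP: p01.
have ss : s ^+ 2 <= s0.
  by rewrite expr2 (le_trans (ler_pM s_ge0 s_ge0 (ltW ss0) (ltW ss0))) // ler_piMr // ltW.
apply: (@le_trans _ _ (16 * s ^+ 2 * B)).
  by apply: ler_wpM2l => //; rewrite mulr_ge0 // sqr_ge0.
by apply: ler_wpM2r => //; apply: ler_wpM2l.
Qed.

Lemma graph1_unique (G H : graph 1) : G = H.
Proof. by apply: graph_ext => i j; rewrite (ord1 i) (ord1 j). Qed.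

Lemma sym_mean_le (R : realType) (n : nat) (g : graph n -> R) (M : R) G :
  (forall H, g H <= M) -> sym_mean g G <= M.
Proof.
move=> gM; rewrite /sym_mean ler_pdivrMr ?ltr0n ?fact_gt0 //.
rewrite mulr_natr -(card_Sn n) -sumr_const.
by apply: ler_sum.
Qed.

Lemma bin2_le_sqr (n : nat) : ('C(n, 2) <= n ^ 2)%N.
Proof. by rewrite bin2 -mulnn; case: n => // n; rewrite /=; lia. Qed.

Lemma sqr_le_pairs (n : nat) : (1 < n)%N -> (n ^ 2 <= 2 * (n * n.-1))%N.
Proof. by rewrite -mulnn; case: n => // n /=; nia. Qed.

(* If [n^2 p^K] is bounded while [n^2 p^(2K-1)] is bounded below, then
   [(n^2 p^K)^(2K-1) = n^(2K-2) (n^2 p^(2K-1))^K] bounds [n], as soon as [K > 1]. *)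
Lemma small_order_bound (R : realType) (K n : nat) (p b c : R) :
  (1 < K)%N -> (0 < n)%N -> 0 <= p -> 0 < c ->
  n%:R ^+ 2 * p ^+ K <= b -> c <= n%:R ^+ 2 * p ^+ (2 * K).-1 ->
  n%:R <= b ^+ (2 * K).-1 / c ^+ K.
Proof.
move=> K1 n0 p0 c0 nb nc; rewrite ler_pdivlMr ?exprn_gt0 //.
have x0 : 0 <= n%:R ^+ 2 * p ^+ K by rewrite mulr_ge0 ?exprn_ge0.
have b0 : 0 <= b by apply: le_trans nb.
apply: (@le_trans _ _ ((n%:R ^+ 2 * p ^+ K) ^+ (2 * K).-1)); last first.
  by apply: lerXn2r; rewrite ?nnegrE.
have -> : (n%:R ^+ 2 * p ^+ K) ^+ (2 * K).-1 =
    n%:R ^+ (2 * K).-2 * (n%:R ^+ 2 * p ^+ (2 * K).-1) ^+ K.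
  rewrite !exprMn -!exprM mulrA -!exprD.
  have -> : ((2 * K).-1 + (2 * K).-1 = (2 * K).-2 + (K + K))%N by lia.
  by rewrite [(K * _)%N]mulnC.
apply: ler_pM; rewrite ?exprn_ge0 ?(ltW c0) //.
  have -> : ((2 * K).-2 = ((2 * K).-2).-1.+1)%N by lia.
  by rewrite exprS ler_peMr // exprn_ege1 // ler1n.
by apply: lerXn2r; rewrite ?nnegrE ?(ltW c0) // (le_trans (ltW c0)).
Qed.

(** [F] takes integer values, so distinct values of [F / m] differ by at least [1 / m >= 1 / M]. *)
Lemma rho_param_spaced (R : realType) (n M : nat) (p : R) (F : graph n -> nat) (G H : graph n) :
  0 < expectation (gnp p) (fun G => (F G)%:R) <= M%:R ->
  rho_param p F G != rho_param p F H ->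
  M%:R^-1 <= `|rho_param p F G - rho_param p F H|.
Proof.
rewrite /rho_param; set m := expectation _ _ => /andP[m0 mM] ne.
rewrite -mulrBl normrM normfV (gtr0_norm m0).
apply: (@le_trans _ _ m^-1); first by rewrite lef_pV2 ?posrE // (lt_le_trans m0).
rewrite ler_peMl ?invr_ge0 ?(ltW m0) //.
have {}ne : F G != F H by apply: contraNneq ne => ->.
move: (F G) (F H) ne => u w.
wlog: u w / (w < u)%N.
  move=> IH uw; case: (ltngtP w u) => [wu|uw'|/esym/eqP]; last by rewrite (negbTE uw).
    exact: IH.
  by rewrite distrC; apply: IH; rewrite // eq_sym.
by move=> wu _; rewrite -natrB ?(ltnW wu) // normr_nat ler1n subn_gt0.
Qed.

(** The point is uniformity: [gam] is fixed before [n], [M], [p] and [F]. It is the minimum of the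
    spacings obtained in the separate cases. *)
Lemma gap_exists (R : realType) (K a : nat) (eps c delta : R) :
  (0 < K)%N -> 0 < eps -> 0 < c -> 0 < delta ->
  exists2 gam : R, 0 < gam <= 1 &
  forall (n M : nat) (p : R) (F g : graph n -> nat),
    (0 < n)%N -> 0 < p -> p <= 1 - delta ->
    c ^+ (2 * K).-1 <= n%:R ^+ 2 * p ^+ (2 * K).-1 ->
    (M <= a * 'C(n, 2) ^ a + a)%N -> (forall G, (g G <= M)%N) ->
    local_on (2 * K) g ->
    (forall G, (F G)%:R = sym_mean (fun H => (g H)%:R) G :> R) ->
    M%:R * (p * delta) ^+ K <= expectation (gnp p) (fun G => (F G)%:R) ->
    0 < expectation (gnp p) (fun G => (F G)%:R) ->
    qc_promise (gnp p) (rho_param p F) eps ->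
  exists lo hi, gap (gnp p) (rho_param p F) eps lo hi gam.
Proof.
move=> K0 e0 c0 d0.
(* Threshold for [n * n.-1 * (p * delta) ^ K] above which the variance of [rho_param] is at most
   [eps ^ 2 / 40]. *)
pose B : R := 40 * (2 * K)%:R ^+ 4 / eps ^+ 2.
have v0 : 0 < (2 * K)%:R :> R by rewrite ltr0n muln_gt0.
have B0 : 0 < B by rewrite divr_gt0 ?mulr_gt0 ?exprn_gt0.
(* The bound on [n] from [small_order_bound] below the threshold when [K > 1]; [m0] then exceeds
   [M]. *)
pose n0 : R := (2 * B / delta ^+ K) ^+ (2 * K).-1 / (c ^+ (2 * K).-1) ^+ K.
have n00 : 0 <= n0.
  apply: divr_ge0; apply: exprn_ge0; last exact/exprn_ge0/ltW.
  by apply: divr_ge0; [apply: mulr_ge0 => //; apply: ltW | apply/exprn_ge0/ltW].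
pose m0 : R := a%:R * (n0 ^+ 2) ^+ a + a%:R + 1.
have m00 : 0 < m0.
  by rewrite ltr_wpDl // addr_ge0 // mulr_ge0 // exprn_ge0 // sqr_ge0.
(* Chosen so that [16 * s0 * (B / delta) = eps ^ 2 / 40], as [gap_single_edge] requires. *)
pose s0 : R := eps ^+ 2 * delta / (640 * B).
have s00 : 0 < s0.
  by apply: divr_gt0; apply: mulr_gt0 => //; apply: exprn_gt0.
pose gam := Num.min (Num.min (eps / 2) 1) (Num.min m0^-1 s0).
have gam0 : 0 < gam by rewrite !lt_min ltr01 invr_gt0 m00 s00 divr_gt0.
have ge : gam <= eps / 2 by rewrite !ge_min lexx.
have g1 : gam <= 1 by rewrite !ge_min lexx orbT.
have gm : gam <= m0^-1 by rewrite !ge_min lexx !orbT.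
have gs : gam <= s0 by rewrite !ge_min lexx !orbT.
exists gam; first by rewrite gam0.
move: gam gam0 ge g1 gm gs => gam gam0 ge g1 gm gs.
move=> n M p F g np p0 pd cp Ma gM gl FE ME EF0 prom.
have p01 : 0 <= p <= 1 by rewrite (ltW p0) /=; lra.
have rge0 G := rho_param_ge0 G EF0.
(* On one vertex there is a single graph, so spacing is vacuous. *)
have [n1|n1] := ltnP 1 n; last first.
  have nE : n = 1%N by apply/eqP; rewrite eqn_leq n1 np.
  apply: gap_spaced => // G H; suff -> : G = H by rewrite eqxx.
  by move: G H {gM gl FE ME EF0 prom rge0}; rewrite nE; apply: graph1_unique.
have gnp0 G : 0 <= gnp p G by apply: gnp_ge0.
have [D DE] : exists D : R, D = (n * n.-1)%:R by eexists.
have D0 : 0 < D by rewrite DE ltr0n muln_gt0 np -subn1 subn_gt0.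
have nD : n%:R ^+ 2 <= 2 * D.
  by rewrite DE -natrX -natrM ler_nat sqr_le_pairs.
have var := variance_rho_param n1 p01 gl gM FE EF0.
have r0 : 0 < (p * delta) ^+ K by rewrite exprn_gt0 // mulr_gt0.
(* Concentrated case: [M] is at most the mean divided by [(p * delta) ^ K], so the variance is at
   most [(2 * K) ^ 4 / B]. *)
have [BD|BD] := leP B (D * (p * delta) ^+ K).
  exists (1 - eps / 2), (1 + eps / 2); apply: gap_concentrated => //.
  - exact: gnp_sum1.
  - exact: expectation_rho_param.
  apply: (le_trans var); rewrite -DE ler_pdivrMr //.
  apply: (@le_trans _ _ (eps ^+ 2 / 40 * (M%:R * (p * delta) ^+ K))); last first.
    by rewrite ler_wpM2l // divr_ge0 // sqr_ge0.
  have vB : (2 * K)%:R ^+ 4 = eps ^+ 2 / 40 * B by rewrite /B; field; rewrite gt_eqF.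
  rewrite vB.
  have -> : eps ^+ 2 / 40 * B / D * M%:R = eps ^+ 2 / 40 * (M%:R * (B / D)).
    by field; rewrite gt_eqF.
  apply: ler_wpM2l; first by rewrite divr_ge0 // sqr_ge0.
  by apply: ler_wpM2l => //; rewrite ler_pdivrMr // mulrC.
have [K1|K1] := ltnP 1 K; last first.
  have KE : K = 1%N by apply/eqP; rewrite eqn_leq K1 K0.
  apply: (@gap_single_edge _ _ _ _ _ (B / delta) _ g) => //.
  - by rewrite gam0.
  - by move: gl; rewrite KE.
  - rewrite -DE ler_pdivlMr // -mulrA; apply: ltW.
    by move: BD; rewrite KE expr1.
  apply: (@le_trans _ _ (16 * s0 * (B / delta))).
    by apply: ler_wpM2r; [rewrite divr_ge0 ?ltW | rewrite ler_pM2l].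
  rewrite /s0 le_eqVlt; apply/orP; left; apply/eqP; field.
  by rewrite (gt_eqF d0) (gt_eqF B0).
(* With [n] bounded, [M] is at most [m0] and integrality of [F] alone gives the spacing. *)
have nn0 : n%:R <= n0.
  apply: (small_order_bound K1 np (ltW p0)) cp; first by rewrite exprn_gt0.
  rewrite ler_pdivlMr ?exprn_gt0 // -mulrA -exprMn.
  apply: (@le_trans _ _ (2 * D * (p * delta) ^+ K)); first by apply: ler_wpM2r => //; apply: ltW.
  by rewrite -mulrA ler_pM2l // ltW.
have EM : expectation (gnp p) (fun G => (F G)%:R) <= M%:R.
  rewrite -(@expectation_cst _ _ _ M%:R (gnp_sum1 n p)).
  by apply: le_expectation => // G; rewrite FE; apply: sym_mean_le => H; rewrite ler_nat.
apply: gap_spaced => // G H ne.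
have EFM : 0 < expectation (gnp p) (fun G => (F G)%:R) <= M%:R by rewrite EF0.
apply: le_trans (rho_param_spaced EFM ne).
apply: (le_trans gm); rewrite lef_pV2 ?posrE //; last exact: lt_le_trans EF0 EM.
apply: (@le_trans _ _ (a%:R * ('C(n, 2)%:R) ^+ a + a%:R)).
  by rewrite -natrX -natrM -natrD ler_nat.
rewrite /m0 -addrA lerD //; last by rewrite lerDl.
apply: ler_wpM2l => //; apply: lerXn2r; rewrite ?nnegrE ?sqr_ge0 //.
apply: (@le_trans _ _ (n%:R ^+ 2)); first by rewrite -natrX ler_nat bin2_le_sqr.
by apply: lerXn2r; rewrite ?nnegrE.
Qed.

(** * Sampling *)

(** The expectation of [h] at [x] plus the sum of [s] independent uniform samples of [Y], in the
    recursive form that the loop of the program unfolds to. *)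
Fixpoint walk (R : realType) (I : finType) (Y : I -> nat) (s : nat)
    (h : nat -> R) (x : nat) : R :=
  if s is s'.+1 then (\sum_i walk Y s' h (x + Y i)%N) / #|I|%:R else h x.

Section Walk.
Variables (R : realType) (I : finType) (Y : I -> nat).
Hypothesis I0 : (0 < #|I|)%N.
Let I0R : 0 < #|I|%:R :> R. Proof. by rewrite ltr0n. Qed.

Lemma le_walk s (h h' : nat -> R) x :
  (forall y, h y <= h' y) -> walk Y s h x <= walk Y s h' x.
Proof.
move=> hh; elim: s x => [|s IH] x //=.
by rewrite ler_wpM2r ?invr_ge0 ?(ltW I0R) //; apply: ler_sum.
Qed.

Lemma walkZ s (h : nat -> R) c x : walk Y s (fun y => c * h y) x = c * walk Y s h x.
Proof.
elim: s x => [|s IH] x //=.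
by under eq_bigr => i _ do rewrite IH; rewrite -mulr_sumr mulrA.
Qed.

Lemma walk_compl s (P : pred nat) x :
  walk Y s (fun y => (~~ P y)%:R) x = 1 - walk Y s (fun y => (P y)%:R) x :> R.
Proof.
elim: s x => [|s IH] x /=; first by case: (P x); rewrite ?subrr ?subr0.
under eq_bigr => i _ do rewrite IH.
by rewrite sumrB sumr_const mulrBl divff // gt_eqF.
Qed.

Let mu : R := (\sum_i (Y i)%:R) / #|I|%:R.
Let sig : R := (\sum_i (Y i)%:R ^+ 2) / #|I|%:R - mu ^+ 2.

(** The sum has mean [x + s * mu] and variance [s * sig]. The start [x] stays general for the
    induction. *)
Lemma walk_sqr s c x :
  walk Y s (fun y => (y%:R - c) ^+ 2) x = (x%:R + s%:R * mu - c) ^+ 2 + s%:R * sig.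
Proof.
elim: s x => [|s IH] x /=; first by rewrite !mul0r !addr0.
under eq_bigr => i _ do rewrite IH natrD.
have -> : \sum_i ((x%:R + (Y i)%:R + s%:R * mu - c) ^+ 2 + s%:R * sig) =
   #|I|%:R * ((x%:R + s%:R * mu - c) ^+ 2 + s%:R * sig)
   + 2 * (x%:R + s%:R * mu - c) * \sum_i (Y i)%:R + \sum_i (Y i)%:R ^+ 2.
  have -> : #|I|%:R * ((x%:R + s%:R * mu - c) ^+ 2 + s%:R * sig) =
      \sum_(i : I) ((x%:R + s%:R * mu - c) ^+ 2 + s%:R * sig).
    by rewrite sumr_const mulr_natl.
  rewrite mulr_sumr -!big_split /=.
  by apply: eq_bigr => i _; ring.
have nz : #|I|%:R != 0 :> R by rewrite gt_eqF.
have -> : \sum_i (Y i)%:R = mu * #|I|%:R by rewrite divfK.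
have -> : \sum_i (Y i)%:R ^+ 2 = (sig + mu ^+ 2) * #|I|%:R by rewrite subrK divfK.
rewrite -natr1; move: nz; move: mu sig #|I|%:R => m r N0 nz.
by field.
Qed.

(** Markov's inequality for the squared deviation, together with [sig <= M * mu], which holds since
    [0 <= Y <= M]. *)
Lemma walk_tail s M (P : pred nat) t :
  (forall i, (Y i <= M)%N) -> 0 < t ->
  (forall y, P y -> t <= `|y%:R - s%:R * mu|) ->
  walk Y s (fun y => (P y)%:R) 0 <= s%:R * M%:R * mu / t ^+ 2.
Proof.
move=> YM t0 tP.
have t20 : 0 < t ^+ 2 by rewrite exprn_gt0.
apply: (@le_trans _ _ (walk Y s (fun y => t ^- 2 * (y%:R - s%:R * mu) ^+ 2) 0)).
  apply: le_walk => y; case: (boolP (P y)) => [/tP tle|_]; last first.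
    by rewrite mulr_ge0 ?sqr_ge0 // invr_ge0 ltW.
  rewrite mulrC ler_pdivlMr // mul1r -(real_normK (num_real (y%:R - _))).
  by apply: lerXn2r; rewrite ?nnegrE // ltW.
rewrite walkZ walk_sqr add0r subrr expr0n add0r mulrC ler_pM2r ?invr_gt0 //.
rewrite -mulrA ler_wpM2l // /sig lerBlDr.
apply: (@le_trans _ _ (M%:R * mu)); last by rewrite lerDl sqr_ge0.
rewrite /mu mulrA ler_pM2r ?invr_gt0 // mulr_sumr; apply: ler_sum => i _.
by rewrite expr2 ler_wpM2r // ler_nat.
Qed.

End Walk.

(** A sample has mean [u * rho]. Large [rho] is harmless if the deviation [del] grows with it: the
    variance is linear in [rho], whereas [del] enters squared. *)
Lemma walk_quarter (R : realType) (I : finType) (Y : I -> nat) (T M : nat)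
    (u rho L eps gam del : R) (P : pred nat) :
  (0 < #|I|)%N -> (forall i, (Y i <= M)%N) ->
  \sum_i (Y i)%:R = #|I|%:R * (u * rho) ->
  0 < u -> M%:R <= L * u -> 0 < eps -> 0 < gam <= 1 ->
  32 * L * (2 + eps) / gam ^+ 2 <= T%:R -> (0 < T)%N ->
  0 <= rho -> gam / 2 <= del -> rho <= 2 + eps + del ->
  (forall y, P y -> T%:R * u * del <= `|y%:R - T%:R * u * rho|) ->
  walk Y T (fun y => (P y)%:R) 0 <= 1 / 4 :> R.
Proof.
move=> I0 YM sY u0 ML e0 /andP[g0 g1] TL T0 r0 gd rd PP.
have I0R : #|I|%:R != 0 :> R by rewrite pnatr_eq0 -lt0n.
have T0R : 0 < T%:R :> R by rewrite ltr0n.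
have d0 : 0 < del by lra.
have muE : (\sum_i (Y i)%:R) / #|I|%:R = u * rho :> R by rewrite sY mulrAC divff // mul1r.
have t0 : 0 < T%:R * u * del by rewrite !mulr_gt0.
apply: le_trans (walk_tail I0 YM t0 _) _; first by move=> y /PP; rewrite muE mulrA.
rewrite muE ler_pdivrMr ?exprn_gt0 //.
apply: (@le_trans _ _ (T%:R * (L * u) * (u * rho))).
  by rewrite ler_wpM2r ?mulr_ge0 ?(ltW u0) // ler_wpM2l.
have -> : 1 / 4 * (T%:R * u * del) ^+ 2 = T%:R * u ^+ 2 * (T%:R / 4 * del ^+ 2) by field.
have -> : T%:R * (L * u) * (u * rho) = T%:R * u ^+ 2 * (L * rho) by ring.
apply: ler_wpM2l; first by rewrite mulr_ge0 // sqr_ge0.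
have L0 : 0 <= L by rewrite -(pmulr_lge0 _ u0); apply: le_trans ML.
apply: (@le_trans _ _ (8 * L * (2 + eps) / gam ^+ 2 * del ^+ 2)); last first.
  apply: ler_wpM2r; first exact: sqr_ge0.
  rewrite ler_pdivlMr //; apply: le_trans TL.
  by rewrite le_eqVlt; apply/orP; left; apply/eqP; field; rewrite gt_eqF.
have -> : 8 * L * (2 + eps) / gam ^+ 2 * del ^+ 2 = L * (8 * (2 + eps) * (del / gam) ^+ 2).
  by field; rewrite gt_eqF.
apply: ler_wpM2l => //; apply: (le_trans rd).
(* What remains is [2 + eps + del <= 8 * (2 + eps) * x ^ 2], which follows from [1 / 2 <= x] and
   [del <= x]. *)
set x := del / gam.
have x1 : 1 / 2 <= x by rewrite ler_pdivlMr //; lra.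
have xd : del <= x by rewrite ler_pdivlMr // ler_piMr // ltW.
have h1 : 0 <= x * (x - 1 / 2) by rewrite mulr_ge0 //; lra.
have h2 : 0 <= (2 + eps) * (x * (x - 1 / 2)) by rewrite mulr_ge0 //; lra.
have h3 : 0 <= eps * (x - 1 / 2) by rewrite mulr_ge0 //; lra.
by lra.
Qed.

(** Vertices are drawn with replacement, and a draw with a repetition counts as 0; this only scales
    the mean by the fraction of good draws. [take n] serves the case [n < v], where [v] vertices
    cannot be distinct. *)
Definition sample (n : nat) (g : graph n -> nat) (v : nat) (G : graph n)
    (phi : v.-tuple 'I_n) : nat :=
  if uniq (take n phi) then g (relabel (perm_of_seq (take n phi)) G) else 0%N.

Definition good_samples (n v : nat) : {set v.-tuple 'I_n} :=
  [set phi : v.-tuple 'I_n | uniq (take n phi)].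

(** Permuting the entries maps good samples to good samples, so the sum may be averaged over all
    permutations [s]. For a fixed sample, [tau phi * s] then runs over the whole group. *)
Lemma sum_sample (R : realType) (n v : nat) (g : graph n -> nat) (G : graph n) :
  local_on v g ->
  \sum_(phi : v.-tuple 'I_n) (sample g G phi)%:R =
  #|good_samples n v|%:R * sym_mean (fun H => (g H)%:R) G :> R.
Proof.
move=> gl; pose Phi := good_samples n v.
pose tau (phi : v.-tuple 'I_n) := perm_of_seq (take n phi).
have -> : \sum_(phi : v.-tuple 'I_n) (sample g G phi)%:R =
    \sum_(phi in Phi) (g (relabel (tau phi) G))%:R :> R.
  rewrite [RHS]big_mkcond; apply: eq_bigr => phi _.
  by rewrite /Phi inE /sample; case: ifP.
have f0 := fact_neq0 R n.
apply: (mulfI f0).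
set S := \sum_(phi in Phi) _.
have -> : n`!%:R * S = \sum_(s : 'S_n) S by rewrite sumr_const card_Sn mulr_natl.
transitivity (\sum_(s : 'S_n) \sum_(phi in Phi) (g (relabel (tau phi * s)%g G))%:R : R).
  apply: eq_bigr => s _.
  have ms : injective (fun phi : v.-tuple 'I_n => [tuple of map s phi]).
    by move=> x y /(congr1 val) /= /(inj_map perm_inj) /val_inj.
  rewrite /S [LHS](reindex_inj ms) /=; apply: eq_big => [phi|phi].
    by rewrite !inE /= -map_take map_inj_uniq //; apply: perm_inj.
  rewrite /Phi inE /= -map_take map_inj_uniq; last exact: perm_inj.
  move=> uphi; congr _%:R; apply: gl => i j iv jv.
  (* The two permutations are only known to agree below [v], which suffices as [g] is local. *)
  have E (x : 'I_n) : (x < v)%N ->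
      tau [tuple of map s phi] x = (tau phi * s)%g x.
    move=> xv; have xs : (x < size (take n phi))%N.
      by rewrite size_take size_tuple; case: ifP.
    rewrite permM /tau /= -map_take (perm_of_seqE x uphi xs).
    rewrite (perm_of_seqE x) ?size_map ?map_inj_uniq //; last exact: perm_inj.
    by rewrite (nth_map x).
  by rewrite !adj_relabel !E.
rewrite exchange_big /= (eq_bigr (fun=> n`!%:R * sym_mean (fun H => (g H)%:R) G)).
  by rewrite sumr_const -/Phi -[LHS]mulr_natl; ring.
by move=> phi _; rewrite mulrC divfK // [RHS](reindex_inj (mulgI (tau phi))).
Qed.

(** A fraction at least [v ^ - v] of the draws is good, independently of [n]. For [v <= n] compare
    factor by factor: [n <= v * (n - i)] for [i < v]. *)
Lemma card_good_samples (n v : nat) : (0 < n)%N ->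
  (n ^ v <= v ^ v * #|good_samples n v|)%N.
Proof.
move=> n0; have [vn|nv] := leqP v n.
  have -> : #|good_samples n v| = (n ^_ v)%N.
    have := card_uniq_tuples v (@predT 'I_n); rewrite card_ord => <-.
    apply: eq_card => phi; rewrite !inE all_predT take_oversize //.
    by rewrite size_tuple.
  have powE x : (x ^ v = \prod_(i < v) x)%N by rewrite prod_nat_const card_ord.
  rewrite ffact_prod !powE -big_split /=.
  by apply: leq_prod => i _; have := ltn_ord i; nia.
apply: (@leq_trans (v ^ v * 1)); first by rewrite muln1 leq_exp2r; lia.
rewrite leq_mul2l; apply/orP; right; apply/card_gt0P.
(* For [n < v] one good draw is enough: all vertices in order, then padding. *)
have sz : size (enum 'I_n ++ nseq (v - n) (Ordinal n0)) == v.
  by rewrite size_cat size_nseq size_enum_ord subnKC // ltnW.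
exists (Tuple sz); rewrite inE /= take_size_cat ?enum_uniq //.
exact: size_enum_ord.
Qed.

(** * Executing straight-line code *)

Fixpoint straight (c : cmd) : bool :=
  match c with
  | Skip | Const _ _ | Arith _ _ _ _ | Fetch _ _ | Store _ _ | Query _ _ _ => true
  | Seq c1 c2 => straight c1 && straight c2
  | _ => false
  end.

Fixpoint exec (W : nat) (O : oracle) (c : cmd) (M : memory) : memory :=
  match c with
  | Const a v => update M a (v %% W)
  | Arith o a b c => update M a (binop_eval o (M b) (M c) %% W)
  | Fetch a b => update M a (M (M b))
  | Store a b => update M (M a) (M b)
  | Query a b c => update M a (O (M b) (M c) %% W)
  | Seq c1 c2 => exec W O c2 (exec W O c1 M)
  | _ => M
  end%N.

Fixpoint cost (c : cmd) : nat :=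
  if c is Seq c1 c2 then (cost c1 + cost c2).+1 else 1.

Fixpoint num_queries (c : cmd) : nat :=
  match c with
  | Query _ _ _ => 1
  | Seq c1 c2 => num_queries c1 + num_queries c2
  | _ => 0
  end%N.

Lemma pr_straight (R : realType) W O b c t st M : straight c ->
  pr_verdict R W O b (cost c + t) (c :: st, M) =
  pr_verdict R W O b t (st, exec W O c M).
Proof.
elim: c t st M => //= c1 IH1 c2 IH2 t st M /andP[s1 s2].
by rewrite -addnA IH1 // IH2.
Qed.

Lemma halts_straight W O c q t st M : straight c ->
  halts_within W O q t (st, exec W O c M) ->
  halts_within W O (num_queries c + q) (cost c + t) (c :: st, M).
Proof.
elim: c q t st M => //= c1 IH1 c2 IH2 q t st M /andP[s1 s2] H.
by rewrite -!addnA; apply: IH1 => //; apply: IH2.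
Qed.

Definition seqs (cs : seq cmd) : cmd := foldr Seq Skip cs.

Lemma straight_seqs cs : straight (seqs cs) = all straight cs.
Proof. by elim: cs => //= c cs ->. Qed.

Lemma exec_seqs W O cs M :
  exec W O (seqs cs) M = foldl (fun M c => exec W O c M) M cs.
Proof. by elim: cs M => //= c cs IH M; rewrite IH. Qed.

Fixpoint write (M : memory) (a : nat) (s : seq nat) : memory :=
  if s is x :: s' then write (update M a x) a.+1 s' else M.

Lemma writeE M a s i :
  write M a s i = if (a <= i < a + size s)%N then nth 0%N s (i - a) else M i.
Proof.
elim: s M a => [|x s IH] M a /=; first by rewrite addn0; case: ifP => //; lia.
rewrite IH /update addSnnS; have [->|ia] := eqVneq i a.
  by rewrite ltnn /= leqnn subnn; case: ifP => //; lia.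
have -> : (a < i)%N = (a <= i)%N by rewrite ltn_neqAle eq_sym ia.
case: ifP => // /andP[ai _]; have -> : (i - a = (i - a.+1).+1)%N by lia.
by [].
Qed.

Definition rands (m a v : nat) : cmd := seqs [seq Rand i m | i <- iota a v].

Lemma sum_tuple_cons (R : realType) (T : finType) (v : nat) (f : seq T -> R) :
  \sum_(phi : v.+1.-tuple T) f phi = \sum_(x : T) \sum_(phi : v.-tuple T) f (x :: phi).
Proof.
rewrite pair_big /=.
rewrite (reindex (fun q : T * v.-tuple T => [tuple of q.1 :: q.2])) //=.
exists (fun phi : v.+1.-tuple T => (thead phi, [tuple of behead phi])).
  by case=> x phi _ /=; congr (_, _); apply: val_inj.
by move=> phi _; rewrite [RHS]tuple_eta.
Qed.

(** The [v] draws take [v] steps, as do the [Seq] nodes around them, and the final [Skip] takes one.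
    The cell [m] with the range lies below the cells that are overwritten. *)
Lemma pr_rands (R : realType) W O b m a v n t st M :
  (0 < n)%N -> (m < a)%N -> M m = n.-1 -> (n <= W)%N ->
  pr_verdict R W O b ((v.*2).+1 + t) (rands m a v :: st, M) =
  (\sum_(phi : v.-tuple 'I_n)
     pr_verdict R W O b t (st, write M a (map val phi))) / (n ^ v)%:R.
Proof.
case: n => // n _ ma Mm nW; rewrite /= in Mm; elim: v a M ma Mm => [|v IH] a M ma Mm.
  rewrite (big_pred1 [tuple]) /=; first by rewrite divr1.
  by move=> phi; apply/esym/eqP/tuple0.
rewrite /rands /= Mm.
rewrite (@sum_tuple_cons _ _ _ (fun phi => pr_verdict R W O b t (st, write M a (map val phi)))).
rewrite (eq_bigr (fun x : 'I_n.+1 => (\sum_(phi : v.-tuple 'I_n.+1)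
     pr_verdict R W O b t (st, write M a (map val (x :: phi)))) / (n.+1 ^ v)%:R)).
  by rewrite -mulr_suml expnSr natrM invfM mulrA.
move=> x _; have := ltn_ord x; rewrite ltnS => xn.
rewrite -/(rands m a.+1 v) modn_small; last exact: leq_ltn_trans xn nW.
rewrite -IH ?leqW //.
by rewrite /update; case: eqP => // ma'; move: ma; rewrite ma' ltnn.
Qed.

Lemma halts_rands W O m a v n q t st M :
  (0 < n)%N -> (m < a)%N -> M m = n.-1 -> (n <= W)%N ->
  (forall phi : v.-tuple 'I_n, halts_within W O q t (st, write M a (map val phi))) ->
  halts_within W O q ((v.*2).+1 + t) (rands m a v :: st, M).
Proof.
case: n => // n _ ma Mm nW; rewrite /= in Mm; elim: v a M ma Mm => [|v IH] a M ma Mm H.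
  exact: (H [tuple]).
rewrite /rands /= Mm => x xn; rewrite -/(rands m a.+1 v).
rewrite modn_small; last exact: leq_ltn_trans xn nW.
apply: IH; rewrite ?leqW //.
  by rewrite /update; case: eqP => // ma'; move: ma; rewrite ma' ltnn.
by move=> phi; apply: (H [tuple of (Ordinal (xn : (x < n.+1)%N)) :: phi]).
Qed.

(** * The program *)

Definition code (x : nat) (bs : seq bool) : nat :=
  foldl (fun (x : nat) (b : bool) => x * 2 + b)%N x bs.

Lemma code_lt x bs : (code x bs < x.+1 * 2 ^ size bs)%N.
Proof.
elim: bs x => [|b bs IH] x /=; first by rewrite muln1.
by apply: (leq_trans (IH _)); rewrite expnS mulnA leq_mul2r; case: b; lia.
Qed.

Lemma code_inj x y bs cs : size bs = size cs -> code x bs = code y cs ->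
  x = y /\ bs = cs.
Proof.
elim: bs x y cs => [|b bs IH] x y [|c cs] //= [] sz E.
have [xy ->] := IH _ _ _ sz E; move: xy; clear E.
by case: b; case: c => xy; split => //; lia.
Qed.

(** Over all ordered pairs, the comparison bits reveal which drawn vertices coincide: those of which
    neither is smaller. The index so formed has a length independent of [n]. *)
Definition pair_bits (O : oracle) (phi : seq nat) (e : nat * nat) : seq bool :=
  [:: O (nth 0 phi e.1) (nth 0 phi e.2); nth 0 phi e.1 < nth 0 phi e.2]%N.

Definition sample_bits (O : oracle) (ps : seq (nat * nat)) (phi : seq nat) : seq bool :=
  flatten [seq pair_bits O phi e | e <- ps].

Lemma size_sample_bits O ps phi : size (sample_bits O ps phi) = (2 * size ps)%N.
Proof. by elim: ps => //= e ps IH; rewrite IH; lia. Qed.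

Definition pair_block (idx tmp two a b : nat) : seq cmd :=
  [:: Query tmp a b; Arith Mul idx idx two; Arith Add idx idx tmp;
      Arith Lt tmp a b; Arith Mul idx idx two; Arith Add idx idx tmp].

Definition exec_all (W : nat) (O : oracle) (cs : seq cmd) (M : memory) : memory :=
  foldl (fun M c => exec W O c M) M cs.

Lemma exec_all_cat W O cs ds M :
  exec_all W O (cs ++ ds) M = exec_all W O ds (exec_all W O cs M).
Proof. exact: foldl_cat. Qed.

Lemma exec_pair_block W O (idx tmp two a b x : nat) (M : memory) :
  idx != tmp -> two != idx -> two != tmp -> a != idx -> a != tmp ->
  b != idx -> b != tmp -> M two = 2%N -> M idx = x -> (x.+1 * 4 <= W)%N ->
  let M' := exec_all W O (pair_block idx tmp two a b) M in
  M' idx = ((x * 2 + O (M a) (M b)) * 2 + (M a < M b))%N /\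
  (forall c, c != idx -> c != tmp -> M' c = M c).
Proof.
move=> it ti tt ai at_ bi bt M2 Mx xW; split; last first.
  by move=> c ci ct; rewrite /= /update (negbTE ci) (negbTE ct).
have ti' : tmp != idx by rewrite eq_sym.
rewrite /= /update !(eqxx, negbTE it, negbTE ti, negbTE tt, negbTE ai, negbTE at_,
  negbTE bi, negbTE bt, negbTE ti') /= M2 Mx.
have o1 : (O (M a) (M b) <= 1)%N by case: (O _ _).
have l1 : ((M a < M b)%N <= 1)%N by case: (_ < _)%N.
move: (nat_of_bool (O _ _)) (nat_of_bool (M a < M b)%N) o1 l1 => y z y1 z1.
by rewrite !(@modn_small _ W) //; lia.
Qed.

Section Program.
Variable v : nat.

Definition pairs : seq (nat * nat) := [seq (i, j) | i <- iota 0 v, j <- iota 0 v].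
Definition table_size : nat := (2 ^ (2 * size pairs))%N.

(* Cell 0 holds n, cells 1, 2, 3 the number of remaining samples and the two
   thresholds; the table starts at cell 4 and is followed by the work space. *)
Definition cell (i : nat) : nat := (4 + table_size + i)%N.
Definition c_cnt := cell 0.
Definition c_idx := cell 1.
Definition c_tmp := cell 2.
Definition c_one := cell 3.
Definition c_two := cell 4.
Definition c_base := cell 5.
Definition c_max := cell 6.
Definition c_phi := cell 7.

Definition setup_code : seq cmd :=
  [:: Const c_one 1; Const c_two 2; Const c_base 4; Arith Defs.Sub c_max 0 c_one].

Definition lookup_code : seq cmd :=
  Const c_idx 0 ::
  flatten [seq pair_block c_idx c_tmp c_two (c_phi + e.1) (c_phi + e.2) | e <- pairs].

Definition count_code : seq cmd :=
  [:: Arith Add c_idx c_idx c_base; Fetch c_tmp c_idx;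
      Arith Add c_cnt c_cnt c_tmp; Arith Defs.Sub 1 1 c_one].

Definition round_code : cmd := seqs (lookup_code ++ count_code).
Definition body_code : cmd := Seq (rands c_max c_phi v) round_code.

Definition verdict_code : cmd :=
  Seq (Arith Lt c_tmp c_cnt 2)
    (If c_tmp Reject (Seq (Arith Lt c_tmp 3 c_cnt) (If c_tmp Reject Accept))).

Definition sampler : cmd :=
  Seq (seqs setup_code) (Seq (While 1 body_code) verdict_code).

Lemma mem_pairs e : e \in pairs -> (e.1 < v)%N && (e.2 < v)%N.
Proof.
by move=> /allpairsP[[i j] [/= iv jv ->]]; move: iv jv; rewrite !mem_iota /= !add0n => -> ->.
Qed.

Lemma exec_pairs W O (phi : seq nat) (ps : seq (nat * nat)) (x : nat) (M : memory) :
  {subset ps <= pairs} -> (forall i, (i < v)%N -> M (c_phi + i)%N = nth 0%N phi i) ->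
  M c_two = 2%N -> M c_idx = x -> (x.+1 * 2 ^ (2 * size ps) <= W)%N ->
  let M' := exec_all W O (flatten
    [seq pair_block c_idx c_tmp c_two (c_phi + e.1) (c_phi + e.2) | e <- ps]) M in
  M' c_idx = code x (sample_bits O ps phi) /\
  (forall c, c != c_idx -> c != c_tmp -> M' c = M c).
Proof.
elim: ps x M => [|e ps IH] x M sub Mphi M2 Mx xW; first by split.
have /andP[e1 e2] : (e.1 < v)%N && (e.2 < v)%N by apply/mem_pairs/sub; rewrite mem_head.
rewrite [size _]/= mulnS expnD mulnA in xW.
have x4 : (x.+1 * 4 <= W)%N.
  by apply: leq_trans xW; rewrite leq_pmulr // expn_gt0.
have [] := @exec_pair_block W O c_idx c_tmp c_two (c_phi + e.1) (c_phi + e.2) x M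
  _ _ _ _ _ _ _ M2 Mx x4; try by rewrite /c_idx /c_tmp /c_two /c_phi /cell; lia.
rewrite !Mphi // => M'x M'fr.
pose blk (e : nat * nat) := pair_block c_idx c_tmp c_two (c_phi + e.1) (c_phi + e.2).
have -> : flatten (map blk (e :: ps)) = blk e ++ flatten (map blk ps) by [].
rewrite exec_all_cat; set M' := exec_all W O (blk e) M in M'x M'fr *.
have [||||N1 N2] := IH _ M' _ _ _ M'x.
- by move=> y ys; apply: sub; rewrite inE ys orbT.
- move=> i iv; rewrite M'fr ?Mphi //; rewrite /c_idx /c_tmp /c_phi /cell; lia.
- by rewrite M'fr //; rewrite /c_idx /c_tmp /c_two /cell; lia.
- apply: leq_trans xW; rewrite leq_mul2r; apply/orP; right.
  by case: (O _ _); case: (nth 0%N phi e.1 < nth 0%N phi e.2)%N; lia.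
split; first by rewrite N1.
by move=> c ci ct; rewrite N2 // M'fr.
Qed.

Lemma round_straight : straight round_code.
Proof.
rewrite /round_code straight_seqs all_cat andbT /lookup_code /=.
by elim: pairs.
Qed.

Section Run.
Variables (W n Mx : nat) (tbl : seq nat) (K : memory) (O : oracle).
Hypothesis W1 : (1 < W)%N.
Hypothesis n0 : (0 < n)%N.
Hypothesis nW : (n <= W)%N.
Hypothesis sizeW : (4 + table_size <= W)%N.
Hypothesis tblM : forall i, (nth 0 tbl i <= Mx)%N.
Hypothesis Kone : K c_one = 1%N.
Hypothesis Ktwo : K c_two = 2%N.
Hypothesis Kbase : K c_base = 4%N.
Hypothesis Kmax : K c_max = n.-1.
Hypothesis Ktbl : forall i, (i < table_size)%N -> K (4 + i)%N = nth 0%N tbl i.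

(** The loop invariant relative to the memory [K] after the setup: [s] rounds remain and the counter
    is [x]. The drawn vertices, from [c_phi] on, and the two scratch cells are left free. *)
Definition framed (s x : nat) (M : memory) : Prop :=
  [/\ M 1%N = s, M c_cnt = x &
      forall c, (c < c_phi)%N -> c != 1%N -> c != c_cnt -> c != c_idx -> c != c_tmp ->
        M c = K c].

Definition sampled (phi : seq nat) : nat :=
  nth 0%N tbl (code 0 (sample_bits O pairs phi)).

Lemma exec_round s x M (phi : v.-tuple 'I_n) :
  framed s.+1 x M -> (s.+1 < W)%N -> (x + Mx < W)%N ->
  framed s (x + sampled (map val phi)) (exec W O round_code (write M c_phi (map val phi))).
Proof.
move=> [M1 Mc Mf] sW xW; set M0 := write M c_phi _.
have sz : size (map val phi) = v by rewrite size_map size_tuple.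
have M0lt c : (c < c_phi)%N -> M0 c = M c.
  by move=> ic; rewrite /M0 writeE leqNgt ic.
have M0phi i : (i < v)%N -> M0 (c_phi + i)%N = nth 0%N (map val phi) i.
  by move=> iv; rewrite /M0 writeE sz leq_addr ltn_add2l iv addKn.
rewrite /round_code exec_seqs -/(exec_all W O _ _) exec_all_cat /lookup_code.
rewrite [X in exec_all W O count_code X]/=.
set M1' := update M0 c_idx _.
have i0 : M1' c_idx = 0%N by rewrite /M1' /update eqxx mod0n.
have tw : M1' c_two = 2%N.
  rewrite /M1' /update M0lt ?Mf //; try by rewrite /c_idx /c_tmp /c_two /c_phi /c_cnt /cell; lia.
  by rewrite ifN //; rewrite /c_idx /c_two /cell; lia.
have ph i : (i < v)%N -> M1' (c_phi + i)%N = nth 0%N (map val phi) i.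
  move=> iv; rewrite /M1' /update M0phi // ifN //.
  by rewrite /c_idx /c_phi /cell; lia.
have pW : (1 * 2 ^ (2 * size pairs) <= W)%N.
  by rewrite mul1n; apply: leq_trans sizeW; rewrite leq_addl.
have [] := @exec_pairs W O (map val phi) pairs 0 M1' (fun e h => h) ph tw i0 pW.
rewrite -/(exec_all W O _ _).
set M2 := exec_all W O _ M1' => M2i M2f.
have M2lt c : (c < c_phi)%N -> c != c_idx -> c != c_tmp -> M2 c = M c.
  by move=> h1 h2 h3; rewrite M2f // /M1' /update (negbTE h2) M0lt.
set k := code 0 _ in M2i.
have kt : (k < table_size)%N.
  by have := code_lt 0 (sample_bits O pairs (map val phi)); rewrite size_sample_bits mul1n.
have Mk : M2 (4 + k)%N = nth 0%N tbl k.
  rewrite M2lt; try by rewrite /c_idx /c_tmp /c_phi /cell; lia.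
  by rewrite Mf ?Ktbl //; rewrite /c_idx /c_tmp /c_phi /c_cnt /cell; lia.
have ne1 c : (4 + table_size <= c)%N -> (1 == c) = false /\ (c == 1%N) = false.
  by move=> h; split; apply/eqP; lia.
have cE i j : (cell i == cell j) = (i == j) by rewrite /cell eqn_add2l.
have clt i : (i < 7)%N -> (cell i < c_phi)%N by rewrite /cell ltn_add2l.
have cne1 i : (cell i == 1%N) = false by apply/eqP; rewrite /cell; lia.
have cne1' i : (1%N == cell i) = false by apply/eqP; rewrite /cell; lia.
have B : M2 c_base = 4%N.
  by rewrite M2lt ?cE ?clt // Mf ?cE ?clt ?cne1.
have On : M2 c_one = 1%N.
  by rewrite M2lt ?cE ?clt // Mf ?cE ?clt ?cne1.
have Ct : M2 c_cnt = x by rewrite M2lt ?cE ?clt.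
have T1 : M2 1%N = s.+1 by rewrite M2lt ?cne1' // /c_phi /cell; lia.
have tk := tblM k.
have ik : ((k + 4) %% W = 4 + k)%N by rewrite modn_small; lia.
have xk : ((x + nth 0 tbl k) %% W = x + nth 0 tbl k)%N by rewrite modn_small; lia.
have sk : ((s.+1 - 1) %% W = s)%N by rewrite modn_small; lia.
split.
- by rewrite /= /update !(cE, cne1, cne1', eqxx) /= T1 On sk.
- have k4 j : (j < table_size)%N -> (4 + j == c_idx)%N = false.
    by move=> jt; apply/eqP; rewrite /c_idx /cell; lia.
  by rewrite /= /update !(cE, cne1, cne1', eqxx) /= M2i B ik k4 // Ct Mk xk.
move=> c cp c1 cc ci ct.
rewrite /= /update (negbTE c1) (negbTE cc) (negbTE ct) (negbTE ci).
by rewrite M2lt // Mf.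
Qed.

Definition body_cost : nat := (((v.*2).+1 + cost round_code).+1).

Lemma loop_step s (M : memory) : M 1%N = s.+1 -> (M 1%N == 0)%N = false.
Proof. by move->. Qed.

Lemma framed_max s x M : framed s x M -> M c_max = n.-1.
Proof.
by move=> [_ _ Mf]; rewrite Mf ?Kmax //; rewrite /c_max /c_phi /c_cnt /c_idx /c_tmp /cell; lia.
Qed.

(** One iteration draws a sample and adds its table entry, which is one step of [walk]. The bound on
    [x + s * Mx] keeps the counter from wrapping around, and the last test of the loop accounts for
    [t0.+1]. *)
Lemma pr_loop (R : realType) b st t0 (h : nat -> R) s x M :
  (forall y M', framed 0 y M' -> pr_verdict R W O b t0 (st, M') = h y) ->
  framed s x M -> (s < W)%N -> (x + s * Mx < W)%N ->
  pr_verdict R W O b (s * body_cost.+1 + t0.+1) (While 1 body_code :: st, M) =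
  walk (fun phi : v.-tuple 'I_n => sampled (map val phi)) s h x.
Proof.
move=> fin; elim: s x M => [|s IH] x M fr sW xW.
  by rewrite /= (let: And3 h _ _ := fr in h) /=; apply: fin.
have M1 : M 1%N = s.+1 by case: fr.
rewrite mulSn addSn /= (loop_step M1) /body_cost addSn /=.
rewrite -!addnA.
have cm : (c_max < c_phi)%N by rewrite /c_max /c_phi /cell ltn_add2l.
have := @pr_rands R W O b c_max c_phi v n
  (cost round_code + (s * body_cost.+1 + t0.+1))%N
  (round_code :: While 1 body_code :: st) M n0 cm (framed_max fr) nW.
rewrite /body_cost !addSn /= => ->.
rewrite card_tuple card_ord; congr (_ / _); apply: eq_bigr => phi _.
rewrite pr_straight; last exact: round_straight.
apply: (IH (x + sampled (map val phi))%N).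
- by apply: exec_round => //; nia.
- exact: ltnW.
- by have := tblM (code 0 (sample_bits O pairs (map val phi))); rewrite /sampled; nia.
Qed.

Lemma halts_loop st q0 t0 s x M :
  (forall y M', framed 0 y M' -> halts_within W O q0 t0 (st, M')) ->
  framed s x M -> (s < W)%N -> (x + s * Mx < W)%N ->
  halts_within W O (s * num_queries round_code + q0) (s * body_cost.+1 + t0.+1)
    (While 1 body_code :: st, M).
Proof.
move=> fin; elim: s x M => [|s IH] x M fr sW xW.
  by rewrite /= (let: And3 h _ _ := fr in h) /=; apply: fin fr.
have M1 : M 1%N = s.+1 by case: fr.
rewrite !mulSn addSn /= (loop_step M1) /body_cost addSn /=.
rewrite -!addnA.
have cm : (c_max < c_phi)%N by rewrite /c_max /c_phi /cell ltn_add2l.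
have := @halts_rands W O c_max c_phi v n
  (num_queries round_code + (s * num_queries round_code + q0))%N
  (cost round_code + (s * body_cost.+1 + t0.+1))%N
  (round_code :: While 1 body_code :: st) M n0 cm (framed_max fr) nW.
rewrite /body_cost !addSn /=; apply=> phi.
apply: halts_straight; first exact: round_straight.
apply: (IH (x + sampled (map val phi))%N).
- by apply: exec_round => //; nia.
- exact: ltnW.
- by have := tblM (code 0 (sample_bits O pairs (map val phi))); rewrite /sampled; nia.
Qed.

Definition accepts (lo hi y : nat) : bool := ~~ (y < lo)%N && ~~ (hi < y)%N.

(** At most six steps: two [Seq], two comparisons and two branchings. Halting itself consumes
    none. *)
Lemma pr_verdict_code (R : realType) b y M :
  framed 0 y M ->
  pr_verdict R W O b 6 ([:: verdict_code], M) = (accepts (K 2%N) (K 3%N) y == b)%:R.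
Proof.
clear n0 nW sizeW tblM Kone Ktwo Kbase Kmax Ktbl.
move=> [_ Mc Mf].
have K2 : M 2%N = K 2%N by apply: Mf; rewrite /c_phi /c_cnt /c_idx /c_tmp /cell; lia.
have K3 : M 3%N = K 3%N by apply: Mf; rewrite /c_phi /c_cnt /c_idx /c_tmp /cell; lia.
have nec : (c_cnt == c_tmp)%N = false by apply/eqP; rewrite /c_cnt /c_tmp /cell; lia.
have bW (c : bool) : (c %% W = c)%N by rewrite modn_small //; case: c => //; lia.
rewrite /verdict_code /= /update eqxx Mc K2 !bW /accepts.
case: (y < K 2)%N => //=.
by rewrite nec Mc K3 bW /update eqxx; case: (K 3 < y)%N.
Qed.

Lemma halts_verdict_code y M :
  framed 0 y M -> halts_within W O 0 6 ([:: verdict_code], M).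
Proof.
move=> _; rewrite /verdict_code /=.
by case: (_ == 0)%N => //=; case: (_ == 0)%N.
Qed.

End Run.
End Program.

(** The 7 is the last loop test plus the six steps of the verdict; the two outer successors are the
    [Seq] nodes of [sampler]. *)
Definition sampler_time (v T : nat) : nat :=
  ((cost (seqs (setup_code v)) + (T * (body_cost v).+1 + 7).+1).+1)%N.

Definition sampler_queries (v T : nat) : nat := (T * num_queries (round_code v))%N.

Section Sampler.
Variables (v W n Mx T lo hi : nat) (tbl : seq nat) (O : oracle).
Hypothesis n0 : (0 < n)%N.
Hypothesis nW : (n < W)%N.
Hypothesis sizeW : (4 + table_size v <= W)%N.
Hypothesis size_tbl : size tbl = table_size v.
Hypothesis tblM : forall i, (nth 0 tbl i <= Mx)%N.
Hypothesis MW : (Mx < W)%N.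
Hypothesis TW : (T < W)%N.
Hypothesis loW : (lo < W)%N.
Hypothesis hiW : (hi < W)%N.
Hypothesis TMW : (T * Mx < W)%N.

Let par := [:: T, lo, hi & tbl].
Let M0 : memory := fun i => (nth 0 (n :: par) i %% W)%N.
Let K := exec W O (seqs (setup_code v)) M0.

Let KE c : (c < cell v 3)%N -> K c = M0 c.
Proof.
move=> ci; rewrite /K /= /update.
by rewrite !ifN //; move: ci; rewrite /c_one /c_two /c_base /c_max /cell; lia.
Qed.

Let W4 : (4 < W)%N.
Proof. by apply: leq_trans sizeW; rewrite -addn1 leq_add2l expn_gt0. Qed.

Let cE i j : (cell v i == cell v j) = (i == j).
Proof. by rewrite /cell eqn_add2l. Qed.

Let M0_0 : M0 0%N = n. Proof. by rewrite /M0 /= modn_small. Qed.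

Let Kone : K (c_one v) = 1%N.
Proof. by rewrite /K /= /update !cE /= modn_small // ltnW // ltnW // ltnW. Qed.

Let Ktwo : K (c_two v) = 2%N.
Proof. by rewrite /K /= /update !cE /= modn_small // ltnW // ltnW. Qed.

Let Kbase : K (c_base v) = 4%N.
Proof. by rewrite /K /= /update !cE /= modn_small. Qed.

Let Kmax : K (c_max v) = n.-1.
Proof.
have ne i : (0%N == cell v i) = false by apply/eqP; rewrite /cell; lia.
rewrite /K /= /update !cE /= M0_0 (@modn_small 1) ?(ltn_trans _ W4) // subn1 modn_small //.
by apply: leq_ltn_trans nW; rewrite leq_pred.
Qed.

Let Ktbl i : (i < table_size v)%N -> K (4 + i)%N = nth 0%N tbl i.
Proof.
move=> it; rewrite KE; last by rewrite /cell; lia.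
by rewrite /M0 /= modn_small //; apply: leq_ltn_trans (tblM i) MW.
Qed.

Let K2 : K 2%N = lo.
Proof. by rewrite KE ?/M0 /= ?modn_small //; rewrite /cell; lia. Qed.

Let K3 : K 3%N = hi.
Proof. by rewrite KE ?/M0 /= ?modn_small //; rewrite /cell; lia. Qed.

Let framedK : framed v K T 0 K.
Proof.
split => //.
  by rewrite KE ?/M0 /= ?modn_small //; rewrite /cell; lia.
rewrite KE; last by rewrite /c_cnt /cell; lia.
by rewrite /M0 nth_default ?mod0n //= size_tbl /c_cnt /cell; lia.
Qed.

Let W1 : (1 < W)%N. Proof. exact: ltn_trans W4. Qed.

Lemma pr_sampler (R : realType) b :
  pr_verdict R W O b (sampler_time v T) (init_config W (sampler v) n par) =
  walk (fun phi : v.-tuple 'I_n => sampled v tbl O (map val phi)) T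
    (fun y => (accepts lo hi y == b)%:R) 0.
Proof.
rewrite /sampler_time /init_config /sampler.
have -> t : pr_verdict R W O b t.+1
   ([:: Seq (seqs (setup_code v)) (Seq (While 1 (body_code v)) (verdict_code v))], M0) =
   pr_verdict R W O b t
   ([:: seqs (setup_code v); Seq (While 1 (body_code v)) (verdict_code v)], M0) by [].
rewrite pr_straight //.
have -> t M : pr_verdict R W O b t.+1 ([:: Seq (While 1 (body_code v)) (verdict_code v)], M) =
   pr_verdict R W O b t ([:: While 1 (body_code v); verdict_code v], M) by [].
apply: (pr_loop W1 n0 (ltnW nW) sizeW tblM Kone Ktwo Kbase Kmax Ktbl) => //.
by move=> y M' fr; rewrite (pr_verdict_code O W1 R b fr) K2 K3.
Qed.

Lemma halts_sampler :
  halts_within W O (sampler_queries v T) (sampler_time v T)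
    (init_config W (sampler v) n par).
Proof.
rewrite /sampler_time /sampler_queries /init_config /sampler.
have -> q t : halts_within W O q t.+1
   ([:: Seq (seqs (setup_code v)) (Seq (While 1 (body_code v)) (verdict_code v))], M0) =
   halts_within W O q t
   ([:: seqs (setup_code v); Seq (While 1 (body_code v)) (verdict_code v)], M0) by [].
apply: (@halts_straight W O (seqs (setup_code v))) => //.
have -> q t M : halts_within W O q t.+1 ([:: Seq (While 1 (body_code v)) (verdict_code v)], M) =
   halts_within W O q t ([:: While 1 (body_code v); verdict_code v], M) by [].
rewrite -[X in halts_within _ _ X _ _]addn0.
apply: (halts_loop W1 n0 (ltnW nW) sizeW tblM Kone Ktwo Kbase Kmax Ktbl) (framedK) _ _ => //.
by move=> y M' fr; apply: (halts_verdict_code W O fr).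
Qed.

End Sampler.

(** * The lookup table *)

Definition sample_code (n v : nat) (G : graph n) (phi : v.-tuple 'I_n) : nat :=
  code 0 (sample_bits (adj_oracle G) (pairs v) (map val phi)).

(** An entry is read off from an arbitrary graph and draw with that index; by [eq_sample_code] the
    choice is immaterial when [g] is local. Indices that never occur hold 0. *)
Definition sample_table (n v : nat) (g : graph n -> nat) : seq nat :=
  mkseq (fun i =>
    if [pick q : graph n * v.-tuple 'I_n | sample_code q.1 q.2 == i] is Some q
    then sample g q.1 q.2 else 0%N) (table_size v).

Lemma sample_le (n v M : nat) (g : graph n -> nat) G (phi : v.-tuple 'I_n) :
  (forall G, g G <= M)%N -> (sample g G phi <= M)%N.
Proof. by move=> gM; rewrite /sample; case: ifP. Qed.

Lemma sample_table_le (n v M : nat) (g : graph n -> nat) i :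
  (forall G, g G <= M)%N -> (nth 0 (sample_table v g) i <= M)%N.
Proof.
move=> gM; have [il|il] := ltnP i (table_size v); last first.
  by rewrite nth_default // size_mkseq.
by rewrite nth_mkseq //; case: pickP => // q _; apply: sample_le.
Qed.

Lemma eq_sample_bits O O' ps phi phi' e :
  sample_bits O ps phi = sample_bits O' ps phi' -> e \in ps ->
  pair_bits O phi e = pair_bits O' phi' e.
Proof.
elim: ps => //= f ps IH [h1 h2 h3]; rewrite inE => /predU1P[->|]; last exact: IH.
by rewrite /pair_bits h1 h2.
Qed.

Lemma adj_oracleE (n : nat) (G : graph n) (i j : 'I_n) : adj_oracle G i j = adj G i j.
Proof. by rewrite /adj_oracle !valK. Qed.

(** Equal codes have equal bits at every pair. The comparison bits decide whether the draw has a
    repetition, and the adjacency bits fix the graph induced on it, which is all that a local [g]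
    reads. *)
Lemma eq_sample_code (n v : nat) (g : graph n -> nat) G H (phi psi : v.-tuple 'I_n) :
  local_on v g -> sample_code G phi = sample_code H psi ->
  sample g G phi = sample g H psi.
Proof.
move=> gl /code_inj[|_ eb]; first by rewrite !size_sample_bits.
have {}eb i j : (i < v)%N -> (j < v)%N ->
    pair_bits (adj_oracle G) (map val phi) (i, j) =
    pair_bits (adj_oracle H) (map val psi) (i, j).
  move=> iv jv; apply: eq_sample_bits eb _; apply/allpairsP.
  by exists (i, j); rewrite !mem_iota iv jv.
have szp (x : v.-tuple 'I_n) : size (map val x) = v by rewrite size_map size_tuple.
have uniqE (x : v.-tuple 'I_n) : uniq (take n x) = uniq (take n (map val x)).
  by rewrite -map_take map_inj_uniq //; apply: val_inj.
have uq (x y : v.-tuple 'I_n) (G1 G2 : graph n) :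
    (forall i j, (i < v)%N -> (j < v)%N ->
      pair_bits (adj_oracle G1) (map val x) (i, j) =
      pair_bits (adj_oracle G2) (map val y) (i, j)) ->
    uniq (take n x) -> uniq (take n y).
  move=> xy; rewrite !uniqE => /(uniqP 0%N) ux; apply/(uniqP 0%N) => i j.
  rewrite !inE !size_take !szp => ilt jlt; have [iv jv] : (i < v)%N /\ (j < v)%N.
    by move: ilt jlt; case: ifP; lia.
  have [il jl] : (i < n)%N /\ (j < n)%N by move: ilt jlt; case: ifP; lia.
  rewrite !nth_take // => yij; apply: ux; rewrite ?inE ?size_take ?szp // !nth_take //.
  case: (xy i j iv jv) => _; case: (xy j i jv iv) => _.
  by rewrite /= yij ltnn; case: ltngtP.
rewrite /sample.
have -> : uniq (take n phi) = uniq (take n psi).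
  apply/idP/idP; first exact: (uq _ _ G H eb).
  by apply: (uq _ _ H G) => i j iv jv; rewrite eb.
case: ifP => // upsi.
have uphi : uniq (take n phi) by apply: (uq _ _ H G) upsi => i j iv jv; rewrite eb.
apply: gl => i j iv jv; rewrite !adj_relabel.
have nthE (x : v.-tuple 'I_n) (u : 'I_n) : uniq (take n x) -> (u < v)%N ->
    nth 0%N (map val x) u = val (perm_of_seq (take n x) u).
  move=> ux uv; rewrite (perm_of_seqE u) //; last first.
    by rewrite size_take size_tuple; case: ifP.
  by rewrite nth_take // (nth_map u) ?size_tuple.
have [] := eb i j iv jv.
by rewrite !nthE // !adj_oracleE.
Qed.

Lemma sampled_table (n v : nat) (g : graph n -> nat) G (phi : v.-tuple 'I_n) :
  local_on v g ->
  sampled v (sample_table v g) (adj_oracle G) (map val phi) = sample g G phi.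
Proof.
move=> gl; rewrite /sampled -/(sample_code G phi) nth_mkseq; last first.
  have := code_lt 0 (sample_bits (adj_oracle G) (pairs v) (map val phi)).
  by rewrite size_sample_bits mul1n.
case: pickP => [q /eqP|/(_ (G, phi))]; last by rewrite eqxx.
exact: eq_sample_code.
Qed.

(** * Correctness *)

Lemma eq_walk (R : realType) (I : finType) (Y Z : I -> nat) s (h h' : nat -> R) x :
  Y =1 Z -> h =1 h' -> walk Y s h x = walk Z s h' x.
Proof.
move=> YZ hh; elim: s x => [|s IH] x /=; first exact: hh.
by congr (_ / _); apply: eq_bigr => i _; rewrite IH YZ.
Qed.

Lemma walk_ge0 (R : realType) (I : finType) (Y : I -> nat) s (h : nat -> R) x :
  (forall y, 0 <= h y) -> 0 <= walk Y s h x.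
Proof.
move=> h0; elim: s x => [|s IH] x //=.
by rewrite divr_ge0 //; apply: sumr_ge0.
Qed.

(** Comparing an integer counter with a real threshold amounts to comparing it with a rounded one:
    [x] is rounded up, [y] down. *)
Lemma nat_thresholds (R : realType) (x y : R) (B : nat) :
  x <= B%:R -> 0 <= y <= B%:R ->
  exists lo hi : nat, [/\ (lo <= B)%N, (hi <= B)%N,
    forall z, (z < lo)%N = (z%:R < x) & forall z, (hi < z)%N = (y < z%:R)].
Proof.
move=> xB /andP[y0 yB].
have exP : exists z, (fun z : nat => x <= z%:R) z by exists B.
case: (ex_minnP exP) => lo lox lomin.
exists lo, (Num.truncn y); split.
- exact: lomin.
- by rewrite -(ler_nat R) (le_trans _ yB) // truncn_le.
- move=> z; apply/idP/idP => [zlo|zx].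
    by rewrite ltNge; apply/negP => /lomin; rewrite leqNgt zlo.
  by rewrite -(ltr_nat R); apply: lt_le_trans lox.
- by move=> z; rewrite truncn_lt_nat.
Qed.

(** Every polynomial bound in [n] fits into words of a constant multiple of [log n] bits: with
    [X = 2 ^ (log n + 1) > n], the factor [X ^ z] absorbs the coefficient and [X ^ e] the power of
    [n]. *)
Lemma word_modulus_ge (R : realType) (Z : R) (e : nat) :
  exists w : nat, forall n, (0 < n)%N ->
    (n < word_modulus w n)%N /\ Z * n%:R ^+ e < (word_modulus w n)%:R.
Proof.
have [z zZ] : exists z : nat, Z <= z%:R.
  by exists (Num.truncn Z).+1; apply/ltW/truncnS_gt.
exists (z + e.+1)%N => n n0; rewrite /word_modulus.
set X := (2 ^ (trunc_log 2 n).+1)%N.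
have nX : (n < X)%N by apply: trunc_log_ltn.
have X2 : (2 <= X)%N by apply: leq_ltn_trans nX.
have -> : (2 ^ ((z + e.+1) * (trunc_log 2 n).+1) = X ^ z * X ^ e.+1)%N.
  by rewrite -expnD /X -expnM mulnC.
have zX : (z < X ^ z)%N by apply: ltn_expl.
have eX : (n ^ e <= X ^ e)%N.
  by case: (e) => // e'; rewrite leq_exp2r // ltnW.
split.
  apply: (leq_trans nX); rewrite expnS mulnCA leq_pmulr // muln_gt0.
  by rewrite !expn_gt0.
apply: (@le_lt_trans _ _ (z * n ^ e)%:R).
  by rewrite natrM natrX ler_wpM2r // exprn_ge0.
rewrite ltr_nat; apply: (@leq_ltn_trans (z * X ^ e.+1)).
  by rewrite leq_mul2l expnS (leq_trans eX) ?orbT // leq_pmull // ltnW.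
by rewrite ltn_mul2r zX expn_gt0 (ltnW X2).
Qed.

Section Correctness.
Variables (R : realType) (n v M T lo' hi' : nat) (F g : graph n -> nat).
Variables (p eps lo hi gam L : R).
Hypothesis n0 : (0 < n)%N.
Hypothesis T0 : (0 < T)%N.
Hypothesis gl : local_on v g.
Hypothesis gM : forall G, (g G <= M)%N.
Hypothesis FE : forall G, (F G)%:R = sym_mean (fun H => (g H)%:R) G :> R.
Let m := expectation (gnp p) (fun G => (F G)%:R).
Hypothesis m0 : 0 < m.
Hypothesis eps0 : 0 < eps.
Hypothesis gam01 : 0 < gam <= 1.
Hypothesis gp : gap (gnp p) (rho_param p F) eps lo hi gam.
(** The normalization for which one sample has mean [u * rho_param p F G]. *)
Let u : R := #|good_samples n v|%:R / (n ^ v)%:R * m.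
Hypothesis u0 : 0 < u.
Hypothesis ML : M%:R <= L * u.
Hypothesis TL : 32 * L * (2 + eps) / gam ^+ 2 <= T%:R.
Hypothesis loE : forall z, (z < lo')%N = (z%:R < T%:R * u * (lo - gam / 2)).
Hypothesis hiE : forall z, (hi' < z)%N = (T%:R * u * (hi + gam / 2) < z%:R).

Let acc := accepts lo' hi'.
Let Pr (P : pred nat) G : R := walk (sample (v := v) g G) T (fun y => (P y)%:R) 0.
Let Tu0 : 0 < T%:R * u. Proof. by rewrite mulr_gt0 // ltr0n. Qed.

Let quarter (P : pred nat) G del :
  gam / 2 <= del -> rho_param p F G <= 2 + eps + del ->
  (forall y, P y -> T%:R * u * del <= `|y%:R - T%:R * u * rho_param p F G|) ->
  Pr P G <= 1 / 4.
Proof.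
move=> gd rd PP.
apply: (walk_quarter _ _ _ u0 ML eps0 gam01 TL T0 (rho_param_ge0 G m0) gd rd PP).
- by rewrite card_tuple card_ord expn_gt0 n0.
- by move=> phi; apply: sample_le.
rewrite sum_sample // -FE card_tuple card_ord /u /rho_param -/m.
by field; rewrite gt_eqF // natrX expf_neq0 // pnatr_eq0 -lt0n.
Qed.

Lemma accept_good G : lo <= rho_param p F G <= hi -> 3 / 4 <= Pr acc G.
Proof.
case/andP: (gam01) => g0 g1; case: gp => hi0 lo1 hi1 _ _ /andP[rlo rhi].
have q : Pr (fun y => ~~ acc y) G <= 1 / 4.
  apply: (@quarter _ _ (gam / 2)) => //; first by lra.
  move=> y; rewrite /acc /accepts negb_and !negbK loE hiE => /orP[h|h].
    rewrite distrC; apply: le_trans (ler_norm _).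
    have : T%:R * u * (lo - gam / 2) <= T%:R * u * (rho_param p F G - gam / 2).
      by rewrite ler_pM2l //; lra.
    by rewrite mulrBr; lra.
  apply: le_trans (ler_norm _).
  have : T%:R * u * (rho_param p F G + gam / 2) <= T%:R * u * (hi + gam / 2).
    by rewrite ler_pM2l //; lra.
  by rewrite mulrDr; lra.
move: q; rewrite /Pr walk_compl; first by lra.
by rewrite card_tuple card_ord expn_gt0 n0.
Qed.

(** [del] is the distance from [rho_param p F G] to the threshold it has to be told apart from. It
    is at least [gam / 2] and grows with the value, so unbounded values are covered too. *)
Lemma reject_bad G : eps < `|rho_param p F G - 1| ->
  2 / 3 <= Pr (fun y => ~~ acc y) G.
Proof.
case/andP: (gam01) => g0 g1; case: gp => hi0 lo1 hi1 _ bad /bad rG.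
suff q : Pr acc G <= 1 / 4.
  by rewrite /Pr walk_compl ?card_tuple ?card_ord ?expn_gt0 ?n0 //; move: q; rewrite /Pr; lra.
case: rG => rG.
  apply: (@quarter _ _ (lo - gam / 2 - rho_param p F G)); [lra|lra|].
  move=> y /andP[]; rewrite loE -leNgt => h _.
  by apply: le_trans (ler_norm _); rewrite mulrBr; lra.
apply: (@quarter _ _ (rho_param p F G - (hi + gam / 2))); [lra|lra|].
move=> y /andP[_]; rewrite hiE -leNgt => h.
by rewrite distrC; apply: le_trans (ler_norm _); rewrite mulrBr; lra.
Qed.

End Correctness.

Lemma sampler_solves_qc (R : realType) (n v M T B W : nat) (F g : graph n -> nat)
    (p eps lo hi gam L : R) :
  (0 < n)%N -> (0 < T)%N -> 0 <= p <= 1 -> local_on v g ->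
  (forall G, (g G <= M)%N) ->
  (forall G, (F G)%:R = sym_mean (fun H => (g H)%:R) G :> R) ->
  let m := expectation (gnp p) (fun G => (F G)%:R) in
  0 < m -> 0 < eps -> 0 < gam <= 1 -> gap (gnp p) (rho_param p F) eps lo hi gam ->
  let u := #|good_samples n v|%:R / (n ^ v)%:R * m in
  0 < u -> M%:R <= L * u -> 32 * L * (2 + eps) / gam ^+ 2 <= T%:R ->
  T%:R * u * (2 + eps) <= B%:R ->
  (n < W)%N -> (4 + table_size v <= W)%N -> (M < W)%N -> (T < W)%N -> (B < W)%N ->
  (T * M < W)%N ->
  exists2 par : seq nat, size par = (3 + table_size v)%N &
    solves_qc p F eps W (sampler v) par (sampler_queries v T) (sampler_time v T).
Proof.
move=> n0 T0 p01 gl gM FE m m0 e0 g01 gp u u0 ML TL TB nW sW MW TW BW TMW.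
case/andP: (g01) => g0 g1; case: (gp) => hi0 lo1 hi1 pr9 _.
have Tu0 : 0 < T%:R * u by rewrite mulr_gt0 // ltr0n.
have [||lo' [hi' [loB hiB loE hiE]]] := @nat_thresholds R
  (T%:R * u * (lo - gam / 2)) (T%:R * u * (hi + gam / 2)) B.
- by apply: le_trans TB; rewrite ler_pM2l //; lra.
- rewrite mulr_ge0 ?(ltW Tu0) //=; last by lra.
  by apply: le_trans TB; rewrite ler_pM2l //; lra.
have szt : size (sample_table v g) = table_size v by rewrite size_mkseq.
exists [:: T, lo', hi' & sample_table v g]; first by rewrite /= szt.
have tM i := sample_table_le v i gM.
have loW := leq_ltn_trans loB BW; have hiW := leq_ltn_trans hiB BW.
split; first by move=> G; apply: halts_sampler szt tM _ _ _ _ _.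
have prE b G : pr_verdict R W (adj_oracle G) b (sampler_time v T)
    (init_config W (sampler v) n [:: T, lo', hi' & sample_table v g]) =
    walk (sample (v := v) g G) T (fun y => (accepts lo' hi' y == b)%:R) 0.
  rewrite (pr_sampler _ n0 nW sW szt tM) //.
  by apply: eq_walk => // phi; rewrite sampled_table.
have gnp0 G : 0 <= gnp p G by apply: gnp_ge0.
split; last first.
  move=> G bad; rewrite prE.
  rewrite (@eq_walk _ _ _ (sample g G) _ _ (fun y => (~~ accepts lo' hi' y)%:R)) //.
    exact: (reject_bad n0 T0 gl gM FE m0 e0 g01 gp u0 ML TL loE hiE bad).
  by move=> y; rewrite eqbF_neg.
(* On mass 9/10 the acceptance probability is at least 3/4, and [27 / 40 >= 2 / 3]. *)
apply: (@le_trans _ _ (3 / 4 * prob (gnp p) (fun G => lo <= rho_param p F G <= hi))).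
  by lra.
rewrite mulrC /prob /expectation mulr_suml [leLHS]big_mkcond; apply: ler_sum => G _.
rewrite prE; case: ifP => [good|_]; last by rewrite mulr_ge0 // walk_ge0.
apply: ler_wpM2l => //.
rewrite (@eq_walk _ _ _ (sample g G) _ _ (fun y => (accepts lo' hi' y)%:R)) //.
  exact: (accept_good n0 T0 gl gM FE m0 e0 g01 gp u0 ML TL loE hiE good).
by move=> y; rewrite eqb_id.
Qed.

Lemma sampler_time_le (v T : nat) : (0 < T)%N ->
  (sampler_time v T <= T * (cost (seqs (setup_code v)) + (body_cost v).+1 + 9))%N.
Proof.
move=> T0; rewrite /sampler_time; move: (cost _) (body_cost v).+1 => x y; nia.
Qed.

Theorem theoremB2 (R : realType) :
  exists C0 : nat,
  forall (k d a : nat) (eps c delta : R),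
    (0 < k)%N -> 0 < eps -> 0 < c -> 0 < delta ->
  exists (prog : cmd) (w l : nat) (C1 : R),
  forall (n : nat) (p : R) (F : graph n -> nat),
    (0 < n)%N ->
    graph_parameter F ->
    sum_NC0 k d a F ->
    c / n%:R `^ (2 / (2 * (k ^ d)%:R - 1)) <= p ->
    p <= 1 - delta ->
    0 < expectation (gnp p) (fun G => (F G)%:R) ->
    qc_promise (gnp p) (rho_param p F) eps ->
  exists (par : seq nat) (q t : nat),
    [/\ (size par <= l)%N,
        q%:R <= C1 * (1 / p) ^+ (C0 * k ^ d),
        t%:R <= C1 * (1 / p) ^+ (C0 * k ^ d) &
        solves_qc p F eps (word_modulus w n) prog par q t].
Proof.
exists 1%N => k d a eps c delta k0 e0 c0 d0.
have K0 : (0 < k ^ d)%N by rewrite expn_gt0 k0.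
have [gam g01 gapP] := gap_exists a K0 e0 c0 d0.
case/andP: (g01) => g0 g1.
pose v := (2 * k ^ d)%N; pose q := (2 * k ^ d).-1.
(* With [P = (1 / p) ^ (k ^ d)], [A * P] is the number of samples asked for by [walk_quarter]. *)
pose A : R := 32 * (v ^ v)%:R / delta ^+ (k ^ d) * (2 + eps) / gam ^+ 2.
have A0 : 0 <= A.
  rewrite /A divr_ge0 ?sqr_ge0 // mulr_ge0 //; last by lra.
  by rewrite divr_ge0 ?mulr_ge0 // exprn_ge0 // ltW.
(* [Z] and the exponent [2 * k ^ d + 2 * a] dominate every number the program handles: the power of
   [1 / p] contributes [n ^ (2 * k ^ d)] and the number of outputs [n ^ (2 * a)]. *)
pose E0 := (Num.truncn (2 + eps)).+1.
pose Z : R := (A + 1) / (c ^+ q) ^+ (k ^ d) * (2 * a + 1)%:R * E0%:R + (4 + table_size v)%:R.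
have [w wP] := word_modulus_ge Z (2 * k ^ d + 2 * a).
(* As at least one sample is taken, the one-time costs can be charged to every sample. *)
pose H := (cost (seqs (setup_code v)) + (body_cost v).+1 + 9 + num_queries (round_code v))%N.
exists (sampler v), w, (3 + table_size v)%N, ((A + 1) * H%:R).
move=> n p F n0 Finv FC cp pd m0 prom.
have [p0 cp'] := powR_root_bound K0 n0 c0 cp.
have p1 : p <= 1 by lra.
have p01 : 0 <= p <= 1 by rewrite (ltW p0).
have [M [g [Ma gM gl FE MP]]] := sum_NC0_sym_mean R k0 Finv FC.
(* [p * delta] lies below [p] and below [delta <= 1 - p], as the lower bound on the mean
   requires. *)
have r0 : 0 < p * delta by rewrite mulr_gt0.
have rp : p * delta <= p by rewrite ler_piMr ?(ltW p0) //; lra.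
have rd : p * delta <= delta by rewrite ler_piMl ?(ltW d0).
have Mm : M%:R * (p * delta) ^+ (k ^ d) <= expectation (gnp p) (fun G => (F G)%:R).
  by apply: MP; lra.
have [lo [hi gp]] := gapP n M p F g n0 p0 pd cp' Ma gM gl FE Mm m0 prom.
set m := expectation _ _ in m0 Mm.
set P := (1 / p) ^+ (1 * k ^ d).
have P1 : 1 <= P by rewrite /P exprn_ege1 // ler_pdivlMr // mul1r.
(* The factor [v ^ v] pays for draws with repetitions, the rest for the ratio between [M] and the
   mean of [F]. *)
pose L : R := (v ^ v)%:R / delta ^+ (k ^ d) * P.
have AE : 32 * L * (2 + eps) / gam ^+ 2 = A * P.
  by rewrite /A /L; field; rewrite expf_neq0 gt_eqF.
pose T := (Num.truncn (A * P)).+1.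
have AP0 : 0 <= A * P by rewrite mulr_ge0 // (le_trans _ P1).
have /andP[T1 T2] := truncn_itv AP0.
have TP : T%:R <= (A + 1) * P by rewrite /T -natr1 mulrDl mul1r lerD.
have nv0 : 0 < (n ^ v)%:R :> R by rewrite ltr0n expn_gt0 n0.
pose kap : R := #|good_samples n v|%:R / (n ^ v)%:R.
have vv0 : 0 < (v ^ v)%:R :> R by rewrite ltr0n expn_gt0 muln_gt0 K0.
have kap1 : 1 <= (v ^ v)%:R * kap.
  by rewrite /kap mulrA ler_pdivlMr // mul1r -natrM ler_nat card_good_samples.
have kap0 : 0 < kap.
  by rewrite -(pmulr_rgt0 _ vv0); apply: lt_le_trans kap1.
have kaple : kap <= 1.
  rewrite /kap ler_pdivrMr // mul1r ler_nat.
  by apply: (leq_trans (max_card _)); rewrite card_tuple card_ord.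
have u0 : 0 < kap * m by rewrite mulr_gt0.
have ML : M%:R <= L * (kap * m).
  have -> : L * (kap * m) = (v ^ v)%:R * kap * (m / (p * delta) ^+ (k ^ d)).
    rewrite /L /P mul1n expr_div_n expr1n exprMn; field.
    by rewrite !expf_neq0 ?gt_eqF.
  apply: (@le_trans _ _ (m / (p * delta) ^+ (k ^ d))).
    by rewrite ler_pdivlMr ?exprn_gt0.
  by rewrite ler_peMl // divr_ge0 ?(ltW m0) // exprn_ge0 // ltW.
have mM : m <= M%:R.
  rewrite -(@expectation_cst _ _ _ M%:R (gnp_sum1 n p)).
  apply: le_expectation => [G|G]; first exact: gnp_ge0.
  by rewrite FE; apply: sym_mean_le => H'; rewrite ler_nat.
pose B := (T * M * E0)%N.
have [nW ZW] := wP n n0.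
(* From [c ^ q <= n ^ 2 * p ^ q <= n ^ 2 * p]: the lower bound on [p] makes the number of samples
   polynomial in [n]. *)
have PN : P <= n%:R ^+ (2 * k ^ d) / (c ^+ q) ^+ (k ^ d).
  rewrite exprM -expr_div_n /P mul1n; apply: lerXn2r.
  - by rewrite nnegrE divr_ge0 // ltW.
  - by rewrite nnegrE divr_ge0 ?exprn_ge0 // ltW.
  rewrite ler_pdivrMr // mulrAC ler_pdivlMr ?exprn_gt0 // mul1r; apply: (le_trans cp').
  rewrite ler_wpM2l ?exprn_ge0 // -/q.
  have -> : q = q.-1.+1 by rewrite prednK // /q -subn1 subn_gt0; case: (k ^ d)%N K0 => // x _; rewrite mulnS.
  by rewrite exprS ler_piMr ?(ltW p0) // exprn_ile1 ?(ltW p0).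
have MN : M.+1%:R <= (2 * a + 1)%:R * n%:R ^+ (2 * a) :> R.
  rewrite -natrX -natrM ler_nat.
  have h1 : (1 <= n ^ (2 * a))%N by rewrite expn_gt0 n0.
  have h2 : ('C(n, 2) ^ a <= n ^ (2 * a))%N.
    by rewrite expnM; case: (a) => // a'; rewrite leq_exp2r // bin2_le_sqr.
  apply: (@leq_trans (a * n ^ (2 * a) + a).+1).
    by rewrite ltnS (leq_trans Ma) // leq_add2r leq_mul2l h2 orbT.
  move: (n ^ (2 * a))%N h1 => y; clear; nia.
(* Using [M.+1] instead of [M] lets this one inequality bound [T], [M], [T * M], [B] and the table
   addresses. *)
have big : ((T * M.+1 * E0 + (4 + table_size v)) < word_modulus w n)%N.
  rewrite -(ltr_nat R); apply: le_lt_trans ZW.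
  have n1 : 1 <= n%:R ^+ (2 * k ^ d + 2 * a) :> R by rewrite exprn_ege1 // ler1n.
  rewrite natrD mulrDl lerD //; last by rewrite ler_peMr.
  rewrite !natrM.
  have -> : (A + 1) / (c ^+ q) ^+ (k ^ d) * (2 * a + 1)%:R * E0%:R * n%:R ^+ (2 * k ^ d + 2 * a)
     = ((A + 1) * (n%:R ^+ (2 * k ^ d) / (c ^+ q) ^+ (k ^ d))) *
       ((2 * a + 1)%:R * n%:R ^+ (2 * a)) * E0%:R.
    by rewrite exprD; ring.
  apply: ler_wpM2r => //; apply: ler_pM => //; apply: (le_trans TP).
  by apply: ler_wpM2l => //; apply: addr_ge0.
have T0 : (0 < T)%N by [].
have E1 : (1 <= E0)%N by [].
have b1 : (4 + table_size v <= word_modulus w n)%N.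
  by apply: ltnW; apply: leq_ltn_trans big; rewrite leq_addl.
have b2 : (T * M.+1 * E0 < word_modulus w n)%N.
  by apply: leq_ltn_trans big; rewrite leq_addr.
have b3 : (T * M.+1 < word_modulus w n)%N.
  by apply: leq_ltn_trans b2; rewrite leq_pmulr.
have [||||||par sp sol] := @sampler_solves_qc R n v M T B (word_modulus w n) F g
    p eps lo hi gam L n0 T0 p01 gl gM FE m0 e0 g01 gp u0 ML _ _ nW b1.
- by rewrite AE ltW.
- rewrite /B !natrM -[X in X <= _]mulrA -[X in _ <= X]mulrA ler_wpM2l // -/m -/kap.
  have km : kap * m <= M%:R.
    by apply: le_trans mM; rewrite ler_piMl // ltW.
  have e2 : 0 <= 2 + eps by lra.
  apply: ler_pM => //; first exact: ltW.
  exact/ltW/truncnS_gt.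
- by apply: leq_ltn_trans b3; rewrite (leq_trans (leqnSn M)) // leq_pmull.
- by apply: leq_ltn_trans b3; rewrite leq_pmulr.
- by apply: leq_ltn_trans b2; rewrite leq_mul2r leq_mul2l leqnSn !orbT.
- by apply: leq_ltn_trans b3; rewrite leq_mul2l leqnSn orbT.
exists par, (sampler_queries v T), (sampler_time v T); split => //.
- by rewrite sp.
- rewrite /sampler_queries natrM mulrAC; apply: ler_pM => //.
  by rewrite ler_nat /H leq_addl.
- apply: (@le_trans _ _ (T * H)%:R).
    by rewrite ler_nat (leq_trans (sampler_time_le v T0)) // leq_mul2l /H leq_addr orbT.
  by rewrite natrM mulrAC; apply: ler_pM.
Qed.
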